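(* The following identities hold: (a) $G_{\{123,132\}}(x,z)=G_{\{123,213\}}(x,z)=\frac{1+xz+(x^2-1)z^2}{1-2z^2}$; (b) $G_{\{231,321\}}(x,z)=G_{\{312,321\}}(x,z)=\frac{1}{1-xz-z^2}$; (c) $G_{\{132,213\}}(x,z)=\frac{1-z^2}{(1-xz)(1-2z^2)}$; (d) $G_{\{231,312\}}(x,z)=\frac{1-z^2}{1-xz-2z^2}$; (e) $G_{\{132,231\}}(x,z)=G_{\{213,231\}}(x,z)=G_{\{132,312\}}(x,z)=G_{\{213,312\}}(x,z)=\frac{1+xz^3}{(1-xz)(1-z^2)}$; (f) $G_{\{132,321\}}(x,z)=G_{\{213,321\}}(x,z)=\frac{1}{(1-xz)(1-z^2)}$; (g) $G_{\{123,231\}}(x,z)=G_{\{123,312\}}(x,z)=\frac{1+xz+(x^2-1)z^2+xz^3+z^4}{(1-z^2)^2}$; (h) $G_{\{123,321\}}(x,z)=1+xz+(x^2+1)z^2+2xz^3+2z^4$.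
   Context: For permutations $\pi=\pi_1\cdots\pi_n\in\mathfrak{S}_n$ and $\sigma\in\mathfrak{S}_m$, $\pi$ contains $\sigma$ if there are indices $i_1<\dots<i_m$ such that $\pi_{i_1}\cdots\pi_{i_m}$ is in the same relative order as $\sigma$; otherwise $\pi$ avoids $\sigma$. An involution is a permutation with $\pi=\pi^{-1}$. For a set $\Sigma$ of patterns, $\mathcal{I}_n(\Sigma)$ is the set of involutions in $\mathfrak{S}_n$ avoiding every pattern in $\Sigma$. $\mathrm{fp}(\pi)=|\{i:\pi_i=i\}|$ and $G_\Sigma(x,z)=\sum_{n\ge0}\sum_{\pi\in\mathcal{I}_n(\Sigma)}x^{\mathrm{fp}(\pi)}z^n$ (the $n=0$ term counts the empty permutation). *)

(* Defs.v *)
From HB Require Import structures.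
From mathcomp Require Import all_boot all_order all_algebra all_fingroup.
From mathcomp Require Import boolp.

Set Implicit Arguments.
Unset Strict Implicit.
Unset Printing Implicit Defensive.

Import GRing.Theory.
Local Open Scope ring_scope.

Record fps (R : Type) := Fps { fps_coef : nat -> R }.

Notation "{ 'fps' R }" := (fps R) (at level 0, format "{ 'fps'  R }").

HB.instance Definition _ (R : Type) := gen_eqMixin {fps R}.
HB.instance Definition _ (R : Type) := gen_choiceMixin {fps R}.

Lemma fpsP (R : Type) (a b : {fps R}) :
  (forall n, fps_coef a n = fps_coef b n) <-> a = b.
Proof.
split=> [|->//]; case: a b => [a] [b] /= eq_ab.
by congr Fps; apply: funext.
Qed.

Section FpsRing.
Variable R : comUnitRingType.
Implicit Types (a b c : {fps R}) (n : nat).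

Definition fps_add a b := Fps (fun n => fps_coef a n + fps_coef b n).
Definition fps_opp a := Fps (fun n => - fps_coef a n).
Definition fpsC (r : R) : {fps R} := Fps (fun n => if n == 0%N then r else 0).
Definition fpsX : {fps R} := Fps (fun n => (n == 1%N)%:R).
Definition fps_mul a b :=
  Fps (fun n => \sum_(i < n.+1) fps_coef a i * fps_coef b (n - i)).

Fact fps_addA : associative fps_add.
Proof. by move=> a b c; apply/fpsP => n /=; rewrite addrA. Qed.
Fact fps_addC : commutative fps_add.
Proof. by move=> a b; apply/fpsP => n /=; rewrite addrC. Qed.
Fact fps_add0 : left_id (fpsC 0) fps_add.
Proof. by move=> a; apply/fpsP => n /=; rewrite if_same add0r. Qed.
Fact fps_addN : left_inverse (fpsC 0) fps_opp fps_add.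
Proof. by move=> a; apply/fpsP => n /=; rewrite if_same addNr. Qed.

HB.instance Definition _ :=
  GRing.isZmodule.Build {fps R} fps_addA fps_addC fps_add0 fps_addN.

Definition fps_trunc n a : {poly R} := \poly_(i < n.+1) fps_coef a i.

Lemma coef_fps_trunc n a i : (i <= n)%N -> (fps_trunc n a)`_i = fps_coef a i.
Proof. by move=> le_in; rewrite coef_poly ltnS le_in. Qed.

Lemma coef_fps_mul n a b i : (i <= n)%N ->
  fps_coef (fps_mul a b) i = (fps_trunc n a * fps_trunc n b)`_i.
Proof.
move=> le_in; rewrite coefM; apply: eq_bigr => j _.
rewrite !coef_fps_trunc //; first exact: leq_trans (leq_subr _ _) le_in.
by apply: leq_trans le_in; rewrite -ltnS.
Qed.

Fact fps_mulC : commutative fps_mul.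
Proof.
by move=> a b; apply/fpsP => n; rewrite !(@coef_fps_mul n) // mulrC.
Qed.

Fact fps_mulA : associative fps_mul.
Proof.
have E a b c n : fps_coef (fps_mul a (fps_mul b c)) n =
    (fps_trunc n a * (fps_trunc n b * fps_trunc n c))`_n.
  rewrite coefM; apply: eq_bigr => j _.
  by rewrite (@coef_fps_mul n) ?leq_subr // coef_fps_trunc // -ltnS.
move=> a b c; apply/fpsP => n.
by rewrite E [fps_mul _ c]fps_mulC E mulrA mulrC.
Qed.

Fact fps_mul1 : left_id (fpsC 1) fps_mul.
Proof.
move=> a; apply/fpsP => n /=; rewrite big_ord_recl /= mul1r subn0.
by rewrite big1 ?addr0 // => i _; rewrite mul0r.
Qed.

Fact fps_mulDl : left_distributive fps_mul fps_add.
Proof.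
move=> a b c; apply/fpsP => n /=; rewrite -big_split /=.
by apply: eq_bigr => i _; rewrite mulrDl.
Qed.

Fact fps_1_neq0 : fpsC 1 != 0.
Proof.
apply/eqP => /(congr1 (fun a => fps_coef a 0)) /= /eqP.
by rewrite oner_eq0.
Qed.

HB.instance Definition _ :=
  GRing.Zmodule_isComNzRing.Build {fps R}
    fps_mulA fps_mulC fps_mul1 fps_mulDl fps_1_neq0.

(* [fps_inv_seq a n] lists the coefficients of the inverse of a in degrees
   n, n - 1, ..., 0, in this order. *)
Fixpoint fps_inv_seq a n : seq R :=
  if n is n'.+1 then
    let s := fps_inv_seq a n' in
    - (fps_coef a 0)^-1 * (\sum_(i < n) fps_coef a i.+1 * s`_i) :: s
  else [:: (fps_coef a 0)^-1].

Definition fps_unit : pred {fps R} :=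
  fun a => fps_coef a 0 \is a GRing.unit.

Definition fps_inv a : {fps R} :=
  if fps_unit a then Fps (fun n => (fps_inv_seq a n)`_0) else a.

Lemma nth_fps_inv_seq a n i : (i <= n)%N ->
  (fps_inv_seq a n)`_i = (fps_inv_seq a (n - i))`_0.
Proof.
by elim: n i => [|n IHn] [|i] //= le_in; rewrite subSS IHn.
Qed.

Fact fps_mulV : {in fps_unit, left_inverse 1 fps_inv *%R}.
Proof.
move=> a ua; rewrite [LHS]mulrC /fps_inv.
have -> : fps_unit a by [].
apply/fpsP => -[|n] /=; rewrite big_ord_recl /=.
  by rewrite big_ord0 addr0 divrr.
rewrite mulrA mulrN divrr // mulN1r.
rewrite [X in - X + _](_ : _ = \sum_(i < n.+1)
   fps_coef a (bump 0 i) * (fps_inv_seq a (n.+1 - bump 0 i))`_0) ?addNr //.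
apply: eq_bigr => i _; rewrite /bump leq0n add1n subSS.
by rewrite [in LHS]nth_fps_inv_seq // -ltnS.
Qed.

Fact fps_unitP a b : b * a = 1 -> fps_unit a.
Proof.
move=> /(congr1 (fun c => fps_coef c 0)) /=.
by rewrite big_ord1 => ba1; apply/unitrPr; exists (fps_coef b 0); rewrite mulrC.
Qed.

Fact fps_inv_out : {in [predC fps_unit], fps_inv =1 id}.
Proof.
move=> a na; rewrite /fps_inv; case: ifP => // ua.
by case/negP: na.
Qed.

HB.instance Definition _ :=
  GRing.ComNzRing_hasMulInverse.Build {fps R} fps_mulV fps_unitP fps_inv_out.

End FpsRing.

Arguments fpsX {R}.

Definition contains (n m : nat) (pi : 'S_n) (sigma : 'S_m) : bool :=
  [exists f : {ffun 'I_m -> 'I_n},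
    [forall i : 'I_m, forall j : 'I_m, (i < j)%N ==> (f i < f j)%N] &&
    [forall i : 'I_m, forall j : 'I_m,
      (pi (f i) < pi (f j))%N == (sigma i < sigma j)%N]].

Definition avoids (n m : nat) (pi : 'S_n) (sigma : 'S_m) : bool :=
  ~~ contains pi sigma.

Definition involution (n : nat) (pi : 'S_n) : bool := pi == (pi^-1)%g.

Definition avoiding_involutions (m : nat) (Sigma : {set 'S_m}) (n : nat) :
    {set 'S_n} :=
  [set pi | involution pi & [forall sigma in Sigma, avoids pi sigma]].

Definition fp (n : nat) (pi : 'S_n) : nat := #|[set i | pi i == i]|.

(* G_Sigma(x, z), a series in z whose coefficients are polynomials in x. *)
Definition fp_gf (m : nat) (Sigma : {set 'S_m}) : {fps {poly int}} :=
  Fps (fun n => \sum_(pi in avoiding_involutions Sigma n) 'X^(fp pi)).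

(* The permutation with one-line notation w; the letters 1, ..., n of the usual
   notation are the ordinals 0, ..., n - 1. *)
Definition perm_of_word (n : nat) (w : n.-tuple 'I_n) (w_uniq : uniq w) : 'S_n :=
  perm (elimT (tuple_uniqP w) w_uniq).

Definition letter1 : 'I_3 := @Ordinal 3 0 isT.
Definition letter2 : 'I_3 := @Ordinal 3 1 isT.
Definition letter3 : 'I_3 := @Ordinal 3 2 isT.

Definition p123 : 'S_3 := @perm_of_word 3 [tuple letter1; letter2; letter3] isT.
Definition p132 : 'S_3 := @perm_of_word 3 [tuple letter1; letter3; letter2] isT.
Definition p213 : 'S_3 := @perm_of_word 3 [tuple letter2; letter1; letter3] isT.
Definition p231 : 'S_3 := @perm_of_word 3 [tuple letter2; letter3; letter1] isT.
Definition p312 : 'S_3 := @perm_of_word 3 [tuple letter3; letter1; letter2] isT.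
Definition p321 : 'S_3 := @perm_of_word 3 [tuple letter3; letter2; letter1] isT.

Lemma perm_of_wordE (n : nat) (w : n.-tuple 'I_n) (w_uniq : uniq w) (i : 'I_n) :
  perm_of_word w_uniq i = tnth w i.
Proof. by rewrite permE. Qed.

(* Main.v *)
(* An involution of {0, ..., n+1} either fixes 0, and is then 1 (+) tau for an
   involution tau of n+1 points, or exchanges 0 with some j+1, and is then
   obtained from an involution tau of n points by inserting the cycle (0 j+1).
   For each pair of patterns (up to inverse and reverse-complement) at most two
   values of j, determined by tau, keep the permutation in the class, so the
   polynomials counting the class by fixed points satisfy linear recurrences of
   order two:
     (a) j = n or n-1 (for n > 0);    (b) fixed 0, or j = 0;
     (c) fixed 0 and tau = id, or j = n, or j = tau 0 <> 0;
     (d) fixed 0, or j = 0, or j = tau 0 + 1;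
     (e) fixed 0, or j = n and tau decreasing;
     (f) fixed 0, or j = tau 0 <> 0, or n = 0;
     (g) fixed 0 or j = 0, with tau decreasing, or j = tau 0 + 1;
     (h) fixed 0, or j = 0, or j = 1, with tau decreasing on at most 2 points.
   Summing the recurrences gives the rational generating functions. *)

Require Import Defs.
From mathcomp Require Import all_boot all_order all_algebra all_fingroup.
From mathcomp Require Import boolp zify ring.

(** * Avoidance for functions on an initial segment of nat *)

Definition avoids12 n (f : nat -> nat) :=
  forall i j, i < j -> j < n -> f i < f j -> False.
Definition avoids21 n (f : nat -> nat) :=
  forall i j, i < j -> j < n -> f j < f i -> False.
Definition avoids123 n (f : nat -> nat) :=
  forall i j k, i < j -> j < k -> k < n -> f i < f j -> f j < f k -> False.
Definition avoids132 n (f : nat -> nat) :=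
  forall i j k, i < j -> j < k -> k < n -> f i < f k -> f k < f j -> False.
Definition avoids213 n (f : nat -> nat) :=
  forall i j k, i < j -> j < k -> k < n -> f j < f i -> f i < f k -> False.
Definition avoids231 n (f : nat -> nat) :=
  forall i j k, i < j -> j < k -> k < n -> f k < f i -> f i < f j -> False.
Definition avoids312 n (f : nat -> nat) :=
  forall i j k, i < j -> j < k -> k < n -> f j < f k -> f k < f i -> False.
Definition avoids321 n (f : nat -> nat) :=
  forall i j k, i < j -> j < k -> k < n -> f k < f j -> f j < f i -> False.

Definition involutive_on n (f : nat -> nat) :=
  forall i, i < n -> f i < n /\ f (f i) = i.

Lemma involutive_on_neq n f p q :
  involutive_on n f -> q < n -> f p <> q -> f q <> p.
Proof. by move=> If qn fpq fqp; apply: fpq; rewrite -fqp; case: (If q qn). Qed.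

Lemma involutive_on_inj n f p q : involutive_on n f ->
  p < n -> q < n -> p <> q -> f p <> f q.
Proof. by move=> If /If[_ fp] /If[_ fq] pq fpq; case: pq; rewrite -fp fpq. Qed.

(** The two patterns are inverse to each other: the values of an occurrence, read as positions, form
    an occurrence of the inverse pattern in the inverse of [f], which is [f]. *)
Lemma avoids231_312 n f : involutive_on n f -> avoids231 n f <-> avoids312 n f.
Proof.
move=> If; split=> A i j k ij jk kn lt1 lt2.
  have jn := ltn_trans jk kn; have lt_in := ltn_trans ij jn.
  have [[[fin fi] [_ fj]] [_ fk]] := (If i lt_in, If j jn, If k kn).
  by apply: (A (f j) (f k) (f i)); rewrite ?fi ?fj ?fk.
have jn := ltn_trans jk kn; have lt_in := ltn_trans ij jn.
have [[[_ fi] [fjn fj]] [_ fk]] := (If i lt_in, If j jn, If k kn).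
by apply: (A (f k) (f i) (f j)); rewrite ?fi ?fj ?fk.
Qed.

(** * Inserting a fixed point or a 2-cycle *)

(* [dsum1 f] is 1 (+) f: it fixes 0. [add_cycle j f] exchanges 0 and [j.+1] and
   acts as [f] on the other points, which [skip j] numbers increasingly. *)
Definition dsum1 (f : nat -> nat) i := if i is i'.+1 then (f i').+1 else 0.

Definition skip j q := if q < j then q.+1 else q.+2.
Definition unskip j i := if i <= j then i.-1 else i.-2.
Definition add_cycle j (f : nat -> nat) (i : nat) : nat :=
  if i == 0 then j.+1 else if i == j.+1 then 0 else skip j (f (unskip j i)).

Lemma skipE j q : q < j /\ skip j q = q.+1 \/ j <= q /\ skip j q = q.+2.
Proof. by rewrite /skip; case: ltnP => ?; [left|right]. Qed.

Lemma skipK j : cancel (skip j) (unskip j).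
Proof.
by move=> q; have := skipE j q; rewrite /unskip; case: (leqP (skip j q) j); lia.
Qed.

Lemma ltn_skip2 j p q : (skip j p < skip j q) = (p < q).
Proof. by have := skipE j p; have := skipE j q; lia. Qed.

Lemma ltn_skipl j p : (skip j p < j.+1) = (p < j).
Proof. by have := skipE j p; lia. Qed.

Lemma ltn_skipr j p : (j.+1 < skip j p) = (j <= p).
Proof. by have := skipE j p; lia. Qed.

Lemma skip_gt0 j p : 0 < skip j p.
Proof. by rewrite /skip; case: ifP. Qed.

Lemma skip_bound j n p : j <= n -> (skip j p < n.+2) = (p < n).
Proof. by have := skipE j p; lia. Qed.

Lemma add_cycle0 j f : add_cycle j f 0 = j.+1. Proof. by []. Qed.

Lemma add_cycle_j j f : add_cycle j f j.+1 = 0.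
Proof. by rewrite /add_cycle /= eqxx. Qed.

Lemma add_cycle_skip j f q : add_cycle j f (skip j q) = skip j (f q).
Proof.
rewrite /add_cycle skipK.
have [[? ->]|[? ->]] := skipE j q; rewrite /=; case: eqP => //; lia.
Qed.

Lemma add_cycle1 j f : 0 < j -> add_cycle j f 1 = skip j (f 0).
Proof. by move=> j0; rewrite -add_cycle_skip /skip j0. Qed.

Lemma skip_surj n j i : i < n.+2 -> j <= n ->
  [\/ i = 0, i = j.+1 | exists2 q, q < n & i = skip j q].
Proof.
move=> lt_in le_jn; have [->|i0] := eqVneq i 0; first by constructor 1.
have [->|ij] := eqVneq i j.+1; first by constructor 2.
constructor 3; exists (unskip j i); have := skipE j (unskip j i);
  rewrite /unskip; case: (leqP i j); lia.
Qed.

Lemma add_cycle_involutive_on n j f : j <= n -> involutive_on n f ->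
  involutive_on n.+2 (add_cycle j f).
Proof.
move=> le_jn If i lt_in;
  have [->|->|[q lt_qn ->]] := skip_surj _ _ _ lt_in le_jn.
- by rewrite add_cycle0 add_cycle_j.
- by rewrite add_cycle_j add_cycle0.
by rewrite !add_cycle_skip skip_bound //; have [lt_fq ->] := If q lt_qn.
Qed.

Ltac add_cycle_simp :=
  rewrite ?add_cycle0 ?add_cycle_j ?add_cycle_skip ?ltn_skip2 ?ltn_skipl
    ?ltn_skipr ?skip_gt0 ?ltnn ?ltn0 //.

(* Reduces avoidance by [add_cycle j f] to the patterns of [f] it stems from:
   each of the chosen points is [0], [j.+1] or [skip j q] for a point [q]. *)
Ltac add_cycle_points p q r f If le :=
  let i := fresh "i" in let k := fresh "k" in let l := fresh "l" in
  let ik := fresh "ik" in let kl := fresh "kl" in let ln := fresh "ln" in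
  let pn := fresh "pn" in let qn := fresh "qn" in let rn := fresh "rn" in
  move=> i k l ik kl ln;
  have [?|?|[p pn ?]] := skip_surj _ _ i (ltn_trans ik (ltn_trans kl ln)) le;
  have [?|?|[q qn ?]] := skip_surj _ _ k (ltn_trans kl ln) le;
  have [?|?|[r rn ?]] := skip_surj _ _ l ln le;
  subst i k l; move: ik kl {ln}; try (have [? _] := If p pn);
  try (have [? _] := If q qn); try (have [? _] := If r rn);
  add_cycle_simp.

(** * Avoidance after inserting a 2-cycle *)

Section AddCycle.
Variables (n j : nat) (f : nat -> nat).
Hypothesis (If : involutive_on n f) (le : j <= n).
Let g := add_cycle j f.
Let Ig : involutive_on n.+2 g. Proof. exact: add_cycle_involutive_on. Qed.
Let g0 : g 0 = j.+1. Proof. by []. Qed.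
Let gj : g j.+1 = 0. Proof. exact: add_cycle_j. Qed.
Let gneq p q : q < n.+2 -> g p <> q -> g q <> p.
Proof. exact: involutive_on_neq. Qed.
Let neq0 q : q < n.+2 -> q <> j.+1 -> 0 < g q.
Proof. by move=> qn qj; rewrite lt0n; apply/eqP/gneq => //; rewrite g0;
  lia. Qed.
Let neqj q : q < n.+2 -> 0 < q -> g q <> j.+1.
Proof. by move=> qn q0; apply/gneq => //; rewrite gj; lia. Qed.

Ltac restrict A p q r := move=> A p q r ? ? ? ? ?;
  apply: (A (skip j p) (skip j q) (skip j r));
  by rewrite ?/g ?add_cycle_skip ?ltn_skip2 ?skip_bound.

(** The increasing map [skip j] carries each occurrence in [f] to one in [g]; likewise for the
    patterns of length 3 below. *)
Lemma avoids12_of_add_cycle : avoids12 n.+2 g -> avoids12 n f.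
Proof.
move=> A p q pq qn fpq; apply: (A (skip j p) (skip j q));
  by rewrite /g ?add_cycle_skip ?ltn_skip2 ?skip_bound.
Qed.
Lemma avoids123_of_add_cycle : avoids123 n.+2 g -> avoids123 n f.
Proof. restrict A p q r. Qed.
Lemma avoids132_of_add_cycle : avoids132 n.+2 g -> avoids132 n f.
Proof. restrict A p q r. Qed.
Lemma avoids213_of_add_cycle : avoids213 n.+2 g -> avoids213 n f.
Proof. restrict A p q r. Qed.
Lemma avoids312_of_add_cycle : avoids312 n.+2 g -> avoids312 n f.
Proof. restrict A p q r. Qed.
Lemma avoids321_of_add_cycle : avoids321 n.+2 g -> avoids321 n f.
Proof. restrict A p q r. Qed.

Lemma avoids21_add_cycle : ~ avoids21 n.+2 g.
Proof. by move/(_ 0 j.+1); rewrite g0 gj !ltnS; apply. Qed.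

Lemma avoids12_add_cycle : avoids12 n.+2 g <-> avoids12 n f /\ j = n.
Proof.
split=> [A|[A jn] i k ik kn].
  split; first exact: avoids12_of_add_cycle.
  have [lt_jn|lt_nj|//] := ltngtP j n; last by lia.
  (* As [g] is its own inverse, [g n.+1] is the position of the largest value. Positions of chosen
     values are obtained this way throughout. *)
  have [mn gm] := Ig n.+1 (ltnSn _).
  by case: (A 0 (g n.+1)) => //; [apply: neq0; lia|rewrite gm g0].
have [?|?|[p ? ?]] := skip_surj _ _ i (ltn_trans ik kn) le;
have [?|?|[q qn ?]] := skip_surj _ _ k kn le; subst i k; move: ik {kn};
  rewrite /g; add_cycle_simp.
- by have [fqn _] := If q qn; rewrite jn leqNgt fqn.
- by rewrite jn leqNgt qn.
by move=> pq; apply: (A p q pq qn).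
Qed.

(** If [j < n.-1], the values [n] and [n.+1] lie above and to the right of the point 0 and make a
    123 or a 132 with it. Otherwise at most one value exceeds [g 0] and at most one position follows
    [j.+1], so neither new point can play the 1, its only possible role. *)
Lemma avoids123_132_add_cycle : 0 < n ->
  avoids123 n.+2 g /\ avoids132 n.+2 g <->
  (avoids123 n f /\ avoids132 n f) /\ (j = n \/ j = n.-1).
Proof.
move=> n0; split=> [[A B]|[[A B] jn]].
  split; first by
    split; [exact: avoids123_of_add_cycle|exact: avoids132_of_add_cycle].
  have [?|lt_jn] := leqP n.-1 j; first by lia.
  have [[m1n gm1] [m2n gm2]] := (Ig n (ltnW (ltnSn _)), Ig n.+1 (ltnSn _)).
  have m1 : 0 < g n by apply: neq0; lia.
  have m2 : 0 < g n.+1 by apply: neq0; lia.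
  exfalso; have [lt12|lt21|eq12] := ltngtP (g n) (g n.+1).
  - by apply: (A 0 (g n) (g n.+1)); rewrite ?gm1 ?gm2 ?g0 //; lia.
  - by apply: (B 0 (g n.+1) (g n)); rewrite ?gm1 ?gm2 ?g0 //; lia.
  by move: gm2; rewrite -eq12 gm1; lia.
by split; rewrite /g; add_cycle_points p q r f If le;
  try have := A p q r; try have := B p q r; lia.
Qed.

(** For [j > 0], the value 1 makes a 321 with the points 0 and [j.+1] if it stands before [j.+1],
    and a 312 if it stands after. For [j = 0] the new points lie below and to the left of all
    others. *)
Lemma avoids312_321_add_cycle : avoids312 n.+2 g /\ avoids321 n.+2 g <->
  (avoids312 n f /\ avoids321 n f) /\ j = 0.
Proof.
split=> [[A B]|[[A B] jn]].
  split; first by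
    split; [exact: avoids312_of_add_cycle|exact: avoids321_of_add_cycle].
  have [//|j0] := posnP j; have [g1n g1] := Ig 1 isT.
  have a0 : 0 < g 1 by apply: neq0; lia.
  have aj : g 1 <> j.+1 by apply: neqj.
  exfalso; have [lt_aj|lt_ja|//] := ltngtP (g 1) j.+1.
    by apply: (B 0 (g 1) j.+1); rewrite ?g1 ?gj ?g0.
  by apply: (A 0 j.+1 (g 1)); rewrite ?g1 ?gj ?g0.
by split; rewrite /g; add_cycle_points p q r f If le;
  try have := A p q r; try have := B p q r; lia.
Qed.

(** When [j] is [f 0] or its successor, comparisons with [j.+1] can become weak inequalities against
    [f 0]; this dichotomy and the next let [lia] split off equality. *)
Let value0 k : 0 < n -> k < n ->
  k = 0 /\ f k = f 0 \/ k <> 0 /\ f k <> f 0.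
Proof.
move=> n0 kn; have [->|/eqP k0] := eqVneq k 0; first by left.
by right; split=> //; apply: (involutive_on_inj n).
Qed.

Let preimage0 k : 0 < n -> k < n ->
  k = f 0 /\ f k = 0 \/ k <> f 0 /\ f k <> 0.
Proof.
move=> n0 kn; have [[_ fk] [_ f0]] := (If k kn, If 0 n0).
have [->|k0] := eqVneq k (f 0); first by left.
by right; split; [apply/eqP|move=> fk0; case/eqP: k0; rewrite -fk0 fk].
Qed.

(** If [j < n], position 1 must carry [j.+2]: a smaller value makes a 213 with the point 0 and the
    maximum, a larger one a 132 with the point 0 and the value [j.+2]. Conversely, such a cycle
    doubles the cycle of 1 and [j.+2] into adjacent increasing pairs, and neither pattern has an
    ascent between consecutive values. *)
Lemma avoids132_213_add_cycle : avoids132 n.+2 g /\ avoids213 n.+2 g <->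
  (avoids132 n f /\ avoids213 n f) /\ (j = n \/ 0 < n /\ f 0 <> 0 /\ j = f 0).
Proof.
split=> [[A B]|[[A B] jn]].
  split; first by
    split; [exact: avoids132_of_add_cycle|exact: avoids213_of_add_cycle].
  have [->|/eqP jn] := eqVneq j n; first by left.
  right; have lt_jn : j < n by lia.
  have [mn gm] := Ig n.+1 (ltnSn _).
  have m0 : 0 < g n.+1 by apply: neq0; lia.
  have g10 : g 1 <> j.+1 by apply: neqj.
  have g1 : g 1 = j.+2.
    have [lt_g1|lt_g1|//] := ltngtP (g 1) j.+2.
      have m1 : g n.+1 <> 1 by apply: gneq; lia.
      by case: (B 0 1 (g n.+1)); rewrite ?gm ?g0 //; lia.
    have [an ga] := Ig j.+2 ltac:(lia).
    have a0 : 0 < g j.+2 by apply: neq0; lia.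
    have a1 : g j.+2 <> 1 by apply: gneq; lia.
    by case: (A 0 1 (g j.+2)); rewrite ?ga ?g0 //; lia.
  have j0 : 0 < j by rewrite lt0n; apply/eqP => j0; move: g1 gj; rewrite j0;
    lia.
  by move: g1; rewrite /g add_cycle1 //; have := skipE j (f 0); lia.
move: jn => [jn|[n0 [f00 jf]]].
  by split; rewrite /g; add_cycle_points p q r f If le;
    try have := A p q r; try have := B p q r; lia.
have N k := value0 k n0; have M k := preimage0 k n0.
have [f0n ff0] := If 0 n0.
(* In an occurrence through new points, 0 is traded for [skip j 0] and [j.+1] for [skip j (f 0)],
   which gives an occurrence in [f]. *)
split; rewrite /g; add_cycle_points p q r f If le.
- by move: (N q qn) (N r rn) (A 0 q r); lia.
- by move: (M q qn) (M r rn) (A (f 0) q r); lia.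
- by move: (A p q r); lia.
- by move: (N r rn) (M r rn) (B 0 (f 0) r); lia.
- by move: (N q qn) (N r rn) (B 0 q r); lia.
- by move: (M p pn) (M r rn) (B p (f 0) r); lia.
- by move: (B p q r); lia.
Qed.

(** For [j > 0], position 1 must carry [j]: if it carries less, the value [j] completes a 312 with
    positions 0 and 1; if more, the values [j.+1], 0, 1 form one. Conversely, the new points then
    form decreasing pairs with old neighbours, and 312 has no descent between consecutive values. *)
Lemma avoids312_add_cycle : avoids312 n.+2 g <->
  avoids312 n f /\ (j = 0 \/ 0 < n /\ j = (f 0).+1).
Proof.
split=> [A|[A jn]].
  split; first by exact: avoids312_of_add_cycle.
  have [->|j0] := posnP j; first by left.
  have n0 : 0 < n by lia.
  right; split=> //; have [g1n gg1] := Ig 1 isT.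
  have a0 : 0 < g 1 by apply: neq0; lia.
  have aj : g 1 <> j.+1 by apply: neqj.
  have g1 : g 1 = j.
    have [lt_g1|lt_g1|//] := ltngtP (g 1) j.
      have [bn gb] := Ig j ltac:(lia).
      have b0 : 0 < g j by apply: neq0; lia.
      have b1 : g j <> 1 by apply: gneq; lia.
      by case: (A 0 1 (g j)); rewrite ?gb ?g0 //; lia.
    by case: (A 0 j.+1 (g 1)); rewrite ?gg1 ?gj ?g0 //; lia.
  by move: g1; rewrite /g add_cycle1 //; have := skipE j (f 0); lia.
move: jn => [jn|[n0 jf]].
  by rewrite /g; add_cycle_points p q r f If le; try have := A p q r; lia.
have N k := value0 k n0; have M k := preimage0 k n0.
have [f0n ff0] := If 0 n0.
rewrite /g; add_cycle_points p q r f If le.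
- by move: (N r rn) (M r rn) (A 0 (f 0) r); lia.
- by move: (N q qn) (N r rn) (A 0 q r); lia.
- by move: (M p pn) (M r rn) (A p (f 0) r); lia.
- by move: (A p q r); lia.
Qed.

(** If [j < n], the points 0 and [j.+1] extend to a 312 by the last position when its value is below
    [j.+1], and to a 213 by the maximum otherwise. For [j = n] the point 0 carries the maximum and
    turns each ascent of [f] into a 312. *)
Lemma avoids213_312_add_cycle : avoids213 n.+2 g /\ avoids312 n.+2 g <->
  avoids12 n f /\ j = n.
Proof.
split=> [[A B]|[A jn]].
  have jn : j = n.
    have [lt_jn|lt_nj|//] := ltngtP j n; last by lia.
    have [mn gm] := Ig n.+1 (ltnSn _).
    have m0 : 0 < g n.+1 by apply: neq0; lia.
    have mj : g n.+1 <> j.+1 by apply: neqj.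
    exfalso; have [lt_mj|lt_jm|//] := ltngtP (g n.+1) j.+1.
      by apply: (B 0 j.+1 n.+1); rewrite ?gj ?g0.
    by apply: (A 0 j.+1 (g n.+1)); rewrite ?gm ?gj ?g0.
  split=> // p q pq qn fpq; have [fqn _] := If q qn.
  apply: (B 0 (skip j p) (skip j q));
    rewrite ?skip_gt0 ?ltn_skip2 ?skip_bound //;
    by rewrite /g !add_cycle_skip ?ltn_skip2 ?ltn_skipl ?jn.
by split; rewrite /g; add_cycle_points p q r f If le;
  try have := A p q; try have := A q r; lia.
Qed.

(** For nonempty [f], [j = 0] gives a 213 at positions 0, 1, 2. For [j > 0], position 1 must carry
    [j.+2]: less makes a 321 with 0 and [j.+1]; more makes a 321 or a 213, depending on the side of
    [j.+1] where the value [j.+2] stands. Conversely, the cycle is doubled into increasing pairs,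
    and neither pattern has an ascent between consecutive values. *)
Lemma avoids213_321_add_cycle : avoids213 n.+2 g /\ avoids321 n.+2 g <->
  (avoids213 n f /\ avoids321 n f) /\ (n = 0 \/ f 0 <> 0 /\ j = f 0).
Proof.
split=> [[A B]|[[A B] jn]].
  split; first by
    split; [exact: avoids213_of_add_cycle|exact: avoids321_of_add_cycle].
  have [->|n0] := posnP n; first by left.
  have g1j : g 1 <> j.+1 by apply: neqj.
  have j0 : 0 < j.
    rewrite lt0n; apply/eqP => j0.
    have g2 : 0 < g 2 by apply: neq0; lia.
    have g1 : g 1 = 0 by move: gj; rewrite j0.
    have g21 : g 2 <> 1 by apply: gneq; rewrite ?g1.
    by apply: (A 0 1 2); rewrite ?g1 ?g0 ?j0 //; lia.
  right; have g10 : 0 < g 1 by apply: neq0; lia.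
  have g1 : g 1 = j.+2.
    have [lt_g1|lt_g1|//] := ltngtP (g 1) j.+2.
      by case: (B 0 1 j.+1); rewrite ?gj ?g0 //; lia.
    have [g1n _] := Ig 1 isT; have [an ga] := Ig j.+2 ltac:(lia).
    have a0 : 0 < g j.+2 by apply: neq0; lia.
    have a1 : g j.+2 <> 1 by apply: gneq; lia.
    have aj : g j.+2 <> j.+1 by apply: neqj; lia.
    exfalso; have [lt_aj|lt_ja|//] := ltngtP (g j.+2) j.+1.
      by apply: (B 1 (g j.+2) j.+1); rewrite ?ga ?gj //; lia.
    by apply: (A 0 j.+1 (g j.+2)); rewrite ?ga ?gj ?g0.
  by move: g1; rewrite /g add_cycle1 //; have := skipE j (f 0); lia.
have [n0|n0] := posnP n.
  by split; rewrite /g; add_cycle_points p q r f If le; lia.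
have {jn} [f00 jf] : f 0 <> 0 /\ j = f 0 by lia.
have N k := value0 k n0; have M k := preimage0 k n0.
have [f0n ff0] := If 0 n0.
split; rewrite /g; add_cycle_points p q r f If le.
- by move: (N r rn) (M r rn) (A 0 (f 0) r); lia.
- by move: (N q qn) (N r rn) (A 0 q r); lia.
- by move: (M p pn) (M r rn) (A p (f 0) r); lia.
- by move: (A p q r); lia.
- by move: (N q qn) (M q qn) (B 0 q (f 0)); lia.
- by move: (N q qn) (B 0 q r); lia.
- by move: (M q qn) (B p q (f 0)); lia.
- by move: (B p q r); lia.
Qed.

(** With [j = 0] the point 0 lies below all points of [f], so an ascent of [f] would complete a 123.
    With [j > 0] the analysis of 312 applies, and doubling into decreasing pairs creates no 123. *)
Lemma avoids123_312_add_cycle : avoids123 n.+2 g /\ avoids312 n.+2 g <->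
  avoids12 n f /\ j = 0 \/
  (avoids123 n f /\ avoids312 n f) /\ 0 < n /\ j = (f 0).+1.
Proof.
split=> [[A B]|[[A jn]|[[A B] [n0 jn]]]].
  have [j0|j0] := posnP j.
    left; split=> // p q pq qn fpq.
    apply: (A 0 (skip j p) (skip j q));
      rewrite ?skip_gt0 ?ltn_skip2 ?skip_bound //;
      by rewrite /g !add_cycle_skip ?ltn_skip2 ?ltn_skipr ?j0.
  right; have /avoids312_add_cycle[Bf [j0'|jf]] := B; first by lia.
  by split=> //; split=> //; exact: avoids123_of_add_cycle.
- by split; rewrite /g; add_cycle_points p q r f If le;
    try have := A p q; try have := A q r; lia.
have N k := value0 k n0; have M k := preimage0 k n0.
split; last by apply/avoids312_add_cycle; split=> //; right.
have [f0n ff0] := If 0 n0.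
rewrite /g; add_cycle_points p q r f If le.
- by move: (N q qn) (A 0 q r); lia.
- by move: (M q qn) (A (f 0) q r); lia.
- by move: (A p q r); lia.
Qed.

Lemma avoids123_321_add_cycle : avoids123 n.+2 g /\ avoids321 n.+2 g <->
  avoids12 n f /\ (n <= 2 /\ j = 0 \/ n = 2 /\ j = 1).
Proof.
split=> [[A B]|[A jn]].
  have j2 : j < 2.
    (* For [j >= 2] the values 1 and 2 are below [g 0], hence stand after [j.+1] to avoid 321. In
       increasing order they make a 123 with the value 0, in decreasing order a 321 with the point
       0. *)
    rewrite ltnNge; apply/negP => j2.
    have [[a1 ga] [b2 gb]] := (Ig 1 isT, Ig 2 ltac:(lia)).
    have a0 : 0 < g 1 by apply: neq0; lia.
    have aj : g 1 <> j.+1 by apply: neqj.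
    have b0 : 0 < g 2 by apply: neq0; lia.
    have bj : g 2 <> j.+1 by apply: neqj; lia.
    have [lt_aj|lt_ja|//] := ltngtP (g 1) j.+1.
      by apply: (B 0 (g 1) j.+1); rewrite ?ga ?gj ?g0 //; lia.
    have [lt_bj|lt_jb|//] := ltngtP (g 2) j.+1.
      by apply: (B 0 (g 2) j.+1); rewrite ?gb ?gj ?g0 //; lia.
    have [lt_ab|lt_ba|eq_ab] := ltngtP (g 1) (g 2).
    - by apply: (A j.+1 (g 1) (g 2)); rewrite ?ga ?gb ?gj //; lia.
    - by apply: (B 0 (g 2) (g 1)); rewrite ?ga ?gb ?g0 //; lia.
    by move: gb; rewrite -eq_ab ga.
  (* The cycle of 0 and 2 encloses position 1, which makes a 321 if it is fixed. *)
  have g1j : j = 1 -> 0 < f 0 /\ 1 < n.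
    move=> j1; have g10 : 0 < g 1 by apply: neq0; lia.
    have g20 : g 2 = 0 by move: gj; rewrite j1.
    have g11 : g 1 <> 1.
      by move=> g11; apply: (B 0 1 2); rewrite ?g20 ?g11 ?g0 ?j1 //; lia.
    have g12 : g 1 <> 2 by have := neqj 1 isT isT; rewrite j1.
    have [g1n _] := Ig 1 isT.
    by move: g1n g11 g12; rewrite /g add_cycle1 ?j1 //; have := skipE 1 (f 0);
      lia.
  have dec : avoids12 n f.
    move=> p q pq qn fpq; have [j0|j0] := posnP j.
      apply: (A 0 (skip j p) (skip j q));
        rewrite ?skip_gt0 ?ltn_skip2 ?skip_bound //;
        by rewrite /g !add_cycle_skip ?ltn_skip2 ?ltn_skipr ?j0.
    have j1 : j = 1 by lia.
    (* An ascent of [f] with positive lower value is completed to a 123 by the point 0; otherwise by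
       the point [j.+1] of value 0, which precedes it because [f 0] is not 0. *)
    have [f00 _] := g1j j1; have [fp0|fp0] := posnP (f p).
      have p1 : 0 < p by rewrite lt0n; apply/eqP => p0; move: f00;
        rewrite -p0 fp0.
      apply: (A j.+1 (skip j p) (skip j q));
        rewrite ?ltn_skip2 ?skip_bound ?ltn_skipr //.
      - by rewrite j1.
      - by rewrite gj /g add_cycle_skip skip_gt0.
      by rewrite /g !add_cycle_skip ltn_skip2.
    apply: (A 0 (skip j p) (skip j q));
      rewrite ?skip_gt0 ?ltn_skip2 ?skip_bound //;
      by rewrite /g !add_cycle_skip ?ltn_skip2 ?ltn_skipr ?j1.
  split=> //; have n2 : n <= 2.
    (* Three points on which [f] decreases would form a 321. *)
    rewrite leqNgt; apply/negP => n2; have B' := avoids321_of_add_cycle B.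
    have f01 : f 0 <> f 1 by apply: (involutive_on_inj n) => //; lia.
    have f12 : f 1 <> f 2 by apply: (involutive_on_inj n) => //; lia.
    by move: (B' 0 1 2) (dec 0 1) (dec 1 2); lia.
  by have [j0|j0] := posnP j; [left | right; have := g1j; lia].
have f_rev k : k < n -> f k = n - k.+1.
  move=> kn; have n0 : 0 < n by lia.
  have [f0n _] := If 0 n0; have [n1|n1] := leqP n 1.
    by rewrite (_ : k = 0); lia.
  have [f1n _] := If 1 n1; have := value0 1 n0 n1; have := A 0 1 isT n1.
  by have [->|->] : k = 0 \/ k = 1; lia.
by split; rewrite /g; add_cycle_points p q r f If le;
  try have := f_rev p pn; try have := f_rev q qn; try have := f_rev r rn; lia.
Qed.

End AddCycle.

(** * Avoidance after adding a fixed point at 0 *)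

Section DSum1.
Variables (n : nat) (f : nat -> nat).

Lemma avoids21_dsum1 : avoids21 n.+1 (dsum1 f) <-> avoids21 n f.
Proof.
split=> A; first by move=> p q pq qn; apply: (A p.+1 q.+1).
by move=> [|p] [|q] //= pq qn; apply: A.
Qed.

Lemma avoids12_dsum1 : ~ avoids12 n.+2 (dsum1 f).
Proof. by move/(_ 0 1); apply. Qed.

(** Any two later points make a 123 or a 132 with the point 0. *)
Lemma avoids123_132_dsum1 : involutive_on n f ->
  avoids123 n.+1 (dsum1 f) /\ avoids132 n.+1 (dsum1 f) <-> n <= 1.
Proof.
move=> If; split=> [[A B]|n1].
  have := involutive_on_inj _ _ 0 1 If.
  by move: (A 0 1 2) (B 0 1 2); rewrite /dsum1; lia.
by split=> [] [|p] [|q] [|r]; lia.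
Qed.

(** The point 0 is leftmost and lowest, and neither pattern begins with its smallest letter, so
    occurrences stay inside [f]. The same holds below for 213. *)
Lemma avoids312_321_dsum1 : avoids312 n.+1 (dsum1 f) /\ avoids321 n.+1 (dsum1
  f) <->
  avoids312 n f /\ avoids321 n f.
Proof.
split=> [] [A B]; split.
- by move=> p q r pq qr rn; apply: (A p.+1 q.+1 r.+1).
- by move=> p q r pq qr rn; apply: (B p.+1 q.+1 r.+1).
- by move=> [|p] [|q] [|r] //= pq qr rn; apply: A.
- by move=> [|p] [|q] [|r] //= pq qr rn; apply: B.
Qed.

(** The point 0 turns each descent of [f] into a 132. *)
Lemma avoids132_213_dsum1 : avoids132 n.+1 (dsum1 f) /\ avoids213 n.+1 (dsum1
  f) <->
  avoids21 n f.
Proof.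
split=> [[A B] p q pq qn qp|A]; first exact: (A 0 p.+1 q.+1).
split; by move=> [|p] [|q] [|r] //= pq qr rn; try have := A p q;
  try have := A q r; lia.
Qed.

Lemma avoids312_dsum1 : avoids312 n.+1 (dsum1 f) <-> avoids312 n f.
Proof.
split=> A; first by move=> p q r pq qr rn; apply: (A p.+1 q.+1 r.+1).
by move=> [|p] [|q] [|r] //= pq qr rn; apply: A.
Qed.

Lemma avoids213_312_dsum1 : avoids213 n.+1 (dsum1 f) /\ avoids312 n.+1 (dsum1
  f) <->
  avoids213 n f /\ avoids312 n f.
Proof.
split=> [] [A B]; split.
- by move=> p q r pq qr rn; apply: (A p.+1 q.+1 r.+1).
- by move=> p q r pq qr rn; apply: (B p.+1 q.+1 r.+1).
- by move=> [|p] [|q] [|r] //= pq qr rn; apply: A.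
- by move=> [|p] [|q] [|r] //= pq qr rn; apply: B.
Qed.

Lemma avoids213_321_dsum1 : avoids213 n.+1 (dsum1 f) /\ avoids321 n.+1 (dsum1
  f) <->
  avoids213 n f /\ avoids321 n f.
Proof.
split=> [] [A B]; split.
- by move=> p q r pq qr rn; apply: (A p.+1 q.+1 r.+1).
- by move=> p q r pq qr rn; apply: (B p.+1 q.+1 r.+1).
- by move=> [|p] [|q] [|r] //= pq qr rn; apply: A.
- by move=> [|p] [|q] [|r] //= pq qr rn; apply: B.
Qed.

Lemma avoids123_312_dsum1 : avoids123 n.+1 (dsum1 f) /\ avoids312 n.+1 (dsum1
  f) <->
  avoids12 n f.
Proof.
split=> [[A B] p q pq qn qp|A]; first exact: (A 0 p.+1 q.+1).
split; by move=> [|p] [|q] [|r] //= pq qr rn; try have := A p q;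
  try have := A q r; lia.
Qed.

(** The point 0 turns each ascent of [f] into a 123, so [f] decreases, and three decreasing points
    are a 321. *)
Lemma avoids123_321_dsum1 : involutive_on n f ->
  avoids123 n.+1 (dsum1 f) /\ avoids321 n.+1 (dsum1 f) <->
  avoids12 n f /\ n <= 2.
Proof.
move=> If; split=> [[A B]|[A n2]].
  have dec : avoids12 n f by move=> p q pq qn qp; exact: (A 0 p.+1 q.+1).
  have f01 := involutive_on_inj _ _ 0 1 If;
    have f12 := involutive_on_inj _ _ 1 2 If.
  split=> //; move: (B 1 2 3) (dec 0 1) (dec 1 2); by rewrite /dsum1; lia.
split; by move=> [|p] [|q] [|r] //= pq qr rn; try have := A p q;
  try have := A q r; lia.
Qed.
End DSum1.

Import GRing.Theory.
Local Open Scope ring_scope.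
Set Implicit Arguments.
Unset Strict Implicit.

(** * Involutions of 'S_n as functions on nat *)

(* The identity outside [0, n): with this convention [perm_nat] turns
   [lift_perm] into [dsum1] and [add_cycle] as an equality of functions. *)
Definition perm_nat n (pi : 'S_n) (i : nat) : nat :=
  if insub i is Some k then val (pi k) else i.

Lemma perm_natE n (pi : 'S_n) (i : 'I_n) : perm_nat pi i = pi i :> nat.
Proof. by rewrite /perm_nat valK. Qed.

Lemma perm_nat_out n (pi : 'S_n) i : (n <= i)%N -> perm_nat pi i = i.
Proof. by move=> le_ni; rewrite /perm_nat insubF // ltnNge le_ni. Qed.

Lemma perm_nat_eq n (pi : 'S_n) (g : nat -> nat) :
  (forall i : 'I_n, pi i = g i :> nat) ->
  (forall i, (n <= i)%N -> g i = i) -> perm_nat pi = g.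
Proof.
move=> in_n out_n; apply/funext => i; have [lt_in|le_ni] := ltnP i n.
  by rewrite (perm_natE _ (Ordinal lt_in)) in_n.
by rewrite perm_nat_out ?out_n.
Qed.

Lemma involutionP n (pi : 'S_n) : reflect (involutive pi) (involution pi).
Proof.
apply: (iffP eqP) => [pi_inv i|piK]; first by rewrite {1}pi_inv permK.
by apply/permP => i; apply: (canRL (permK pi)); rewrite piK.
Qed.

Lemma perm_nat_involutive_on n (pi : 'S_n) : involution pi ->
  involutive_on n (perm_nat pi).
Proof.
move/involutionP => piK i lt_in; rewrite (perm_natE pi (Ordinal lt_in)).
by rewrite ltn_ord perm_natE piK.
Qed.

Lemma fpE n (pi : 'S_n) : fp pi = (\sum_i (pi i == i))%N.
Proof. by rewrite /fp -sum1dep_card big_mkcond; apply: eq_bigr => i _;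
  case: eqP. Qed.

(** * Inserting points into permutations *)

Section LiftPerm.
Variables (n : nat) (i0 j0 : 'I_n.+1).

Lemma lift_perm_inj : injective (@lift_perm n i0 j0).
Proof.
move=> s t /permP st; apply/permP => i; apply: (@lift_inj _ j0).
by have := st (lift i0 i); rewrite !lift_perm_lift.
Qed.

Lemma lift_perm_surj (pi : 'S_n.+1) :
  pi i0 = j0 -> exists tau, pi = lift_perm i0 j0 tau.
Proof.
move=> pi0.
have /fin_all_exists [t tE] k : exists l, pi (lift i0 k) = lift j0 l.
  case: (unliftP j0 (pi (lift i0 k))) => [l ->|]; first by exists l.
  by rewrite -{1}pi0 => /perm_inj/esym/eqP; rewrite (negPf (neq_lift _ _)).
have t_inj : injective t.
  by move=> k l tkl; apply: (@lift_inj _ i0); apply: (@perm_inj _ pi);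
    rewrite !tE tkl.
exists (perm t_inj); apply/permP => i; case: (unliftP i0 i) => [k|] ->.
  by rewrite lift_perm_lift permE.
by rewrite lift_perm_id.
Qed.
End LiftPerm.

Section AddPoints.
Variable n : nat.

Definition perm_dsum1 (tau : 'S_n) : 'S_n.+1 := lift_perm ord0 ord0 tau.

Lemma perm_nat_dsum1 (tau : 'S_n) :
  perm_nat (perm_dsum1 tau) = dsum1 (perm_nat tau).
Proof.
apply: perm_nat_eq => [i|[//|i] le_ni] /=; last by rewrite perm_nat_out.
case: (unliftP ord0 i) => [k|] ->; last by rewrite lift_perm_id.
by rewrite lift_perm_lift /= perm_natE.
Qed.

Lemma involution_dsum1 (tau : 'S_n) : involution (perm_dsum1 tau) = involution
  tau.
Proof.
by rewrite /involution /perm_dsum1 lift_permV (inj_eq (@lift_perm_inj _ _ _)).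
Qed.

Lemma fp_dsum1 (tau : 'S_n) : fp (perm_dsum1 tau) = (fp tau).+1.
Proof.
rewrite !fpE big_ord_recl.
rewrite lift_perm_id eqxx add1n; congr _.+1; apply: eq_bigr => i _.
by rewrite lift_perm_lift (inj_eq (@lift_inj _ _)).
Qed.

(** The outer lift sends 0 to [j.+1]; the inner one sends [j] to 0, which becomes [j.+1] to 0 after
    the outer lift. *)
Definition perm_add_cycle (j : 'I_n.+1) (tau : 'S_n) : 'S_n.+2 :=
  lift_perm ord0 (lift ord0 j) (lift_perm j ord0 tau).

Lemma perm_add_cycle0 j tau : perm_add_cycle j tau ord0 = lift ord0 j.
Proof. exact: lift_perm_id. Qed.

Lemma perm_add_cycle_j j tau : perm_add_cycle j tau (lift ord0 j) = ord0.
Proof. by apply: val_inj;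
  rewrite /perm_add_cycle lift_perm_lift lift_perm_id. Qed.

Lemma perm_add_cycle_lift j tau k :
  perm_add_cycle j tau (lift ord0 (lift j k)) = lift ord0 (lift j (tau k)).
Proof.
rewrite /perm_add_cycle !lift_perm_lift; apply: val_inj => /=.
by rewrite /bump /=; lia.
Qed.

Lemma perm_add_cycle_case (j : 'I_n.+1) (i : 'I_n.+2) :
  [\/ i = ord0, i = lift ord0 j | exists k, i = lift ord0 (lift j k)].
Proof.
case: (unliftP ord0 i) => [k ->|]; last by constructor 1.
case: (unliftP j k) => [l ->|->]; last by constructor 2.
by constructor 3; exists l.
Qed.

Lemma val_lift_skip (j : 'I_n.+1) (k : 'I_n) : lift ord0 (lift j k) = skip j k
  :> nat.
Proof. by rewrite /= /bump /skip leq0n; case: leqP; rewrite ?add0n ?add1n. Qed.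

Lemma perm_nat_add_cycle j tau :
  perm_nat (perm_add_cycle j tau) = add_cycle j (perm_nat tau).
Proof.
apply: perm_nat_eq => i; last first.
  move=> le_ni; have le_jn := ltn_ord j.
  have -> : i = skip j i.-2 by have := skipE j i.-2; lia.
  rewrite add_cycle_skip perm_nat_out //; lia.
case: (perm_add_cycle_case j i) => [->|->|[k ->]].
- by rewrite perm_add_cycle0.
- by rewrite perm_add_cycle_j add_cycle_j.
by rewrite perm_add_cycle_lift !val_lift_skip add_cycle_skip perm_natE.
Qed.

Lemma perm_add_cycle_inj j : injective (perm_add_cycle j).
Proof. by move=> s t /lift_perm_inj /lift_perm_inj. Qed.

Lemma involution_add_cycle j tau :
  involution (perm_add_cycle j tau) = involution tau.
Proof.
apply/involutionP/involutionP => [piK k|tauK i].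
  have := piK (lift ord0 (lift j k)); rewrite !perm_add_cycle_lift.
  by move/lift_inj/lift_inj.
case: (perm_add_cycle_case j i) => [->|->|[k ->]].
- by rewrite perm_add_cycle0 perm_add_cycle_j.
- by rewrite perm_add_cycle_j perm_add_cycle0.
by rewrite !perm_add_cycle_lift tauK.
Qed.

Lemma fp_add_cycle j tau : fp (perm_add_cycle j tau) = fp tau.
Proof.
rewrite !fpE big_ord_recl.
rewrite perm_add_cycle0 eq_sym (negPf (neq_lift _ _)) add0n.
rewrite (bigD1_ord j) //= perm_add_cycle_j (negPf (neq_lift _ _)) add0n.
by apply: eq_bigr => k _; rewrite perm_add_cycle_lift !(inj_eq (@lift_inj _ _)).
Qed.

Lemma perm_add_cycle_surj j pi : involution pi -> pi ord0 = lift ord0 j ->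
  exists tau, pi = perm_add_cycle j tau.
Proof.
move=> /involutionP piK pi0; have [rho def_pi] := lift_perm_surj pi0.
have pij : pi (lift ord0 j) = ord0 by rewrite -pi0 piK.
have [|tau def_rho] := @lift_perm_surj _ j ord0 rho.
  by apply: val_inj; move/(congr1 val): pij;
    rewrite def_pi lift_perm_lift /= /bump; case: leqP; lia.
by exists tau; rewrite def_pi def_rho.
Qed.
End AddPoints.

(** * Sums over classes of involutions *)

Definition inv_sum n (P : (nat -> nat) -> Prop) : {poly int} :=
  \sum_(pi : 'S_n | involution pi && `[< P (perm_nat pi) >]) 'X^(fp pi).

Lemma eq_inv_sum n (P Q : (nat -> nat) -> Prop) :
  (forall f, involutive_on n f -> P f <-> Q f) -> inv_sum n P = inv_sum n Q.
Proof.
move=> PQ; apply: eq_bigl => pi; case: (boolP (involution pi)) => //= pi_inv.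
by apply: asbool_equiv_eq; apply/PQ/perm_nat_involutive_on.
Qed.

Lemma inv_sum0 n (P : (nat -> nat) -> Prop) :
  (forall f, involutive_on n f -> ~ P f) -> inv_sum n P = 0.
Proof.
move=> nP; apply: big_pred0 => pi; apply/negP => /andP[/perm_nat_involutive_on].
by move=> /nP nPpi /asboolP.
Qed.

Lemma inv_sum_small n (P : (nat -> nat) -> Prop) : (n <= 1)%N ->
  (forall f, involutive_on n f -> P f) -> inv_sum n P = 'X^n.
Proof.
move=> n1 allP; have all1 (pi : 'S_n) : pi = 1%g.
  apply/permP => i; apply: ord_inj;
    move: (ltn_ord (pi i)) (ltn_ord ((1%g : 'S_n) i)); lia.
rewrite /inv_sum (big_pred1 (1%g : 'S_n)) => [|pi].
  rewrite fpE (eq_bigr (fun=> 1%N)) => [|i _]; last by rewrite perm1 eqxx.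
  by rewrite sum_nat_const card_ord muln1.
rewrite (all1 pi) /= eqxx;
  have inv1 : involution (1%g : 'S_n) by rewrite /involution invg1.
by rewrite inv1; apply/asboolP/allP/perm_nat_involutive_on.
Qed.

(** The sum is partitioned by the value at 0: the fibre over 0 is the image of [perm_dsum1], the
    fibre over [j.+1] the image of [perm_add_cycle j]. *)
Lemma sum_involution_recl n (F : 'S_n.+2 -> {poly int}) :
  \sum_(pi | involution pi) F pi =
  \sum_(tau | involution tau) F (perm_dsum1 tau) +
  \sum_(j < n.+1) \sum_(tau | involution tau) F (perm_add_cycle j tau).
Proof.
rewrite (partition_big (fun pi : 'S_n.+2 => pi ord0) predT) //= big_ord_recl.
congr (_ + _); last apply: eq_bigr => j _.
  pose h := @perm_dsum1 n.+1.
  transitivity (\sum_(pi in h @: [set tau | involution tau]) F pi).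
    apply: eq_bigl => pi; apply/andP/imsetP => [[pi_inv /eqP pi0]|[tau]].
      have [tau def_pi] := lift_perm_surj pi0.
      by exists tau => //;
        rewrite inE -(involution_dsum1 tau) /perm_dsum1 -def_pi.
    by rewrite inE => tau_inv ->;
      rewrite involution_dsum1 /h /perm_dsum1 lift_perm_id.
  rewrite big_imset /=; last by move=> s t _ _ /lift_perm_inj.
  by apply: eq_bigl => tau; rewrite inE.
transitivity (\sum_(pi in perm_add_cycle j @: [set tau | involution tau]) F pi).
  apply: eq_bigl => pi; apply/andP/imsetP => [[pi_inv /eqP pi0]|[tau]].
    have [tau def_pi] := perm_add_cycle_surj pi_inv pi0.
    by exists tau => //; rewrite inE -(involution_add_cycle j) -def_pi.
  by rewrite inE => tau_inv ->; rewrite involution_add_cycle perm_add_cycle0.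
rewrite big_imset /=; last by move=> s t _ _ /perm_add_cycle_inj.
by apply: eq_bigl => tau; rewrite inE.
Qed.

Lemma sum_ord_if n (b : bool) k (v : {poly int}) : (b -> (k <= n)%N) ->
  \sum_(j < n.+1) (if b && (j == k :> nat) then v else 0) = if b then v else 0.
Proof.
case: b => [/(_ isT) le_kn|_]; last by rewrite big1.
rewrite -big_mkcond (big_pred1 (Ordinal (le_kn : (k < n.+1)%N))) //.
Qed.

(** The common form of all the recurrences. A new fixed point contributes ['X] and a new cycle
    contributes 1; [j1] and [j2] must differ where both apply, so that two distinct permutations are
    counted. *)
Lemma inv_sum_rec n (P P0 P1 P2 : (nat -> nat) -> Prop) (j1 j2 :
  (nat -> nat) -> nat) :
  (forall f, involutive_on n.+1 f -> P (dsum1 f) <-> P0 f) ->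
  (forall j f, involutive_on n f -> (j <= n)%N ->
     P (add_cycle j f) <-> P1 f /\ j = j1 f \/ P2 f /\ j = j2 f) ->
  (forall f, involutive_on n f -> P1 f -> (j1 f <= n)%N) ->
  (forall f, involutive_on n f -> P2 f -> (j2 f <= n)%N) ->
  (forall f, involutive_on n f -> P1 f -> P2 f -> j1 f <> j2 f) ->
  inv_sum n.+2 P = 'X * inv_sum n.+1 P0 + (inv_sum n P1 + inv_sum n P2).
Proof.
move=> PP0 PP12 j1n j2n j12; rewrite /inv_sum big_mkcondr sum_involution_recl.
congr (_ + _).
  rewrite mulr_sumr [RHS]big_mkcondr; apply: eq_bigr => tau tau_inv.
  rewrite perm_nat_dsum1 fp_dsum1 exprS.
  by rewrite (asbool_equiv_eq (PP0 _ (perm_nat_involutive_on tau_inv))).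
under eq_bigr => j _ do under eq_bigr => tau _ do
  rewrite perm_nat_add_cycle fp_add_cycle.
rewrite exchange_big /= [X in _ = X + _]big_mkcondr [X in _ = _ + X]big_mkcondr.
rewrite -big_split /=; apply: eq_bigr => tau /perm_nat_involutive_on.
move: (perm_nat tau) 'X^(fp tau) => f v If.
(* Each single term is spread into a sum over [j] supported at one position, so that both sides are
   compared for each [j]. *)
rewrite -(@sum_ord_if n _ (j1 f)) => [|/asboolP]; last exact: j1n.
rewrite -(@sum_ord_if n _ (j2 f)) => [|/asboolP]; last exact: j2n.
rewrite -big_split /=; apply: eq_bigr => j _.
have asbool_eqn k : `[<(j : nat) = k>] = (j == k :> nat) by apply/asboolP/eqP.
rewrite (asbool_equiv_eq (PP12 j f If (ltn_ord j))) asbool_or !asbool_and.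
rewrite !asbool_eqn; case: (asboolP (P1 f)) => p1; last by rewrite /= add0r.
case: (asboolP (P2 f)) => p2 /=; last by rewrite orbF addr0.
have := j12 f If p1 p2.
by case: (eqVneq (j : nat) (j1 f)) => [->|_] => [/eqP/negPf->|_] /=;
  rewrite ?addr0 ?add0r.
Qed.

(** * The patterns of length 3 *)

Lemma letterP (a : 'I_3) : [\/ a = letter1, a = letter2 | a = letter3].
Proof.
by case: a => [[|[|[|//]]] lt_a]; [constructor 1|constructor 2|constructor 3];
  apply: val_inj.
Qed.

Lemma avoidsP n (pi : 'S_n) (sigma : 'S_3) (g := perm_nat pi) :
  avoids pi sigma <->
  (forall i j k, (i < j)%N -> (j < k)%N -> (k < n)%N ->
    (g i < g j)%N = (sigma letter1 < sigma letter2)%N ->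
    (g i < g k)%N = (sigma letter1 < sigma letter3)%N ->
    (g j < g k)%N = (sigma letter2 < sigma letter3)%N -> False).
Proof.
rewrite /avoids; split=> [/negP nc i j k ij jk kn s12 s13 s23|nc].
  have jn := ltn_trans jk kn; have lt_in := ltn_trans ij jn.
  pose f : {ffun 'I_3 -> 'I_n} :=
    [ffun a => tnth [tuple Ordinal lt_in; Ordinal jn; Ordinal kn] a].
  have f1 : f letter1 = Ordinal lt_in by rewrite ffunE.
  have f2 : f letter2 = Ordinal jn by rewrite ffunE.
  have f3 : f letter3 = Ordinal kn by rewrite ffunE.
  apply: nc; apply/existsP; exists f; apply/andP; split.
    apply/forallP => a; apply/forallP => b; apply/implyP.
    by case: (letterP a) => ->; case: (letterP b) => -> //;
      rewrite ?f1 ?f2 ?f3 //= => _; apply: ltn_trans jk.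
  have gE x (xn : (x < n)%N) : pi (Ordinal xn) = g x :> nat.
    by rewrite /g (perm_natE _ (Ordinal xn)).
  (* By injectivity a reversed comparison is a negation, so the three given comparisons determine
     the relative order. *)
  have ltC m (rho : 'S_m) a b : a != b ->
    (rho b < rho a)%N = ~~ (rho a < rho b)%N.
    by move=> ab;
      rewrite -leqNgt [RHS]leq_eqVlt val_eqE (inj_eq perm_inj) eq_sym (negPf
        ab).
  have gC x y (xn : (x < n)%N) (yn : (y < n)%N) :
    (x < y)%N -> (g y < g x)%N = ~~ (g x < g y)%N.
    by move=> xy; rewrite -(gE x xn) -(gE y yn) ltC // -val_eqE /= ltn_eqF.
  apply/forallP => a; apply/forallP => b; apply/eqP.
  case: (letterP a) => ->; case: (letterP b) => ->;
    rewrite ?f1 ?f2 ?f3 ?gE ?ltnn //.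
  - by rewrite gC // s12 -ltC.
  - by rewrite gC ?s13 -?ltC //; apply: ltn_trans jk.
  by rewrite gC // s23 -ltC.
apply/negP => /existsP[f /andP[/forallP f_mono /forallP f_iso]].
have lt (a b : 'I_3) : (a < b)%N -> (f a < f b)%N by move:
  (f_mono a) => /forallP/(_ b)/implyP.
have iso (a b : 'I_3) : (g (f a) < g (f b))%N = (sigma a < sigma b)%N.
  by rewrite /g !perm_natE; have /forallP/(_ b)/eqP := f_iso a.
by apply: (nc (f letter1) (f letter2) (f letter3)); rewrite ?lt.
Qed.

Section Patterns.
Variables (n : nat) (pi : 'S_n).
Let g := perm_nat pi.

Let ltn_g i j : (i < j)%N -> (j < n)%N -> (g j < g i)%N = ~~ (g i < g j)%N.
Proof.
move=> ij jn; have lt_in := ltn_trans ij jn.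
rewrite -leqNgt [RHS]leq_eqVlt [X in _ = X || _](_ : _ = false) //.
rewrite /g (perm_natE _ (Ordinal lt_in)) (perm_natE _ (Ordinal jn)) val_eqE.
by rewrite (inj_eq perm_inj) -val_eqE /= gtn_eqF.
Qed.

Ltac pattern_eq A i j k :=
  let ij := fresh "ij" in let jk := fresh "jk" in let kn := fresh "kn" in
  let jn := fresh "jn" in let ik := fresh "ik" in
  rewrite avoidsP !perm_of_wordE /= -/g; split=> A i j k ij jk kn;
  have jn := ltn_trans jk kn; have ik := ltn_trans ij jk;
  have := A i j k ij jk kn; rewrite ?(ltn_g ij jn, ltn_g jk kn, ltn_g ik kn);
  case: (ltnP (g i) (g j)); case: (ltnP (g i) (g k)); case: (ltnP (g j) (g k));
  rewrite /= //; lia.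

Lemma avoids_p123 : avoids pi p123 <-> avoids123 n (perm_nat pi).
Proof. pattern_eq A i j k. Qed.
Lemma avoids_p132 : avoids pi p132 <-> avoids132 n (perm_nat pi).
Proof. pattern_eq A i j k. Qed.
Lemma avoids_p213 : avoids pi p213 <-> avoids213 n (perm_nat pi).
Proof. pattern_eq A i j k. Qed.
Lemma avoids_p231 : avoids pi p231 <-> avoids231 n (perm_nat pi).
Proof. pattern_eq A i j k. Qed.
Lemma avoids_p312 : avoids pi p312 <-> avoids312 n (perm_nat pi).
Proof. pattern_eq A i j k. Qed.
Lemma avoids_p321 : avoids pi p321 <-> avoids321 n (perm_nat pi).
Proof. pattern_eq A i j k. Qed.
End Patterns.

Lemma fp_gf_pair (sigma tau : 'S_3) (P Q : nat -> (nat -> nat) -> Prop) :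
  (forall n (pi : 'S_n), avoids pi sigma <-> P n (perm_nat pi)) ->
  (forall n (pi : 'S_n), avoids pi tau <-> Q n (perm_nat pi)) ->
  fp_gf [set sigma; tau] = Fps (fun n => inv_sum n (fun f => P n f /\ Q n f)).
Proof.
move=> sP tQ; apply/fpsP => n; apply: eq_bigl => pi; rewrite inE; congr andb.
apply/forall_inP/asboolP => [A|[Ppi Qpi] rho].
  by rewrite -sP -tQ; split; apply: A; rewrite !inE eqxx ?orbT.
by rewrite !inE => /orP[] /eqP->; [apply/sP|apply/tQ].
Qed.

(** * Reverse-complement symmetry *)

Definition reverse_complement n (f : nat -> nat) i :=
  if (i < n)%N then (n.-1 - f (n.-1 - i))%N else i.

(** Reverse-complement is conjugation by the order-reversing permutation, which preserves
    involutions and the number of fixed points. *)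
Lemma inv_sum_reverse_complement n P :
  inv_sum n P = inv_sum n (fun f => P (reverse_complement n f)).
Proof.
pose rho : 'S_n := perm (@rev_ord_inj n).
have rhoV : rho^-1%g = rho.
  by apply/eqP; rewrite eq_invg_mul; apply/eqP/permP => i;
    rewrite permM !permE rev_ordK.
have JE (pi : 'S_n) i : (pi ^ rho)%g i = rev_ord (pi (rev_ord i)).
  by rewrite /conjg rhoV !permM !permE.
rewrite /inv_sum (reindex_inj (conjg_inj rho)); apply: eq_big => [pi|pi _].
  congr andb; first by rewrite /involution -conjVg (inj_eq (conjg_inj rho)).
  congr `[< P _ >]; apply: perm_nat_eq => [i|i le_ni];
    rewrite /reverse_complement.
    rewrite ltn_ord JE /= -perm_natE /=; move: (perm_nat pi) (ltn_ord i) => g.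
    have -> : (n - i.+1 = n.-1 - i)%N by lia.
    by lia.
  by rewrite ltnNge le_ni.
congr ('X^_); rewrite !fpE (reindex_inj (@rev_ord_inj n)).
by apply: eq_bigr => i _; rewrite JE rev_ordK (inj_eq (@rev_ord_inj n)).
Qed.

Lemma reverse_complementE n f i : (i < n)%N ->
  reverse_complement n f i = (n.-1 - f (n.-1 - i))%N.
Proof. by rewrite /reverse_complement => ->. Qed.

Section ReverseComplement.
Variables (n : nat) (f : nat -> nat).
Hypothesis If : involutive_on n f.

Let rc_lt i j : (i < n)%N -> (j < n)%N ->
  (reverse_complement n f i < reverse_complement n f j)%N =
  (f (n.-1 - j) < f (n.-1 - i))%N.
Proof.
move=> lt_in jn; rewrite !reverse_complementE //.
by have [] := @If (n.-1 - i)%N; have [] := @If (n.-1 - j)%N; lia.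
Qed.

Let rev_lt i j : (i < j)%N -> (j < n)%N -> (n.-1 - j < n.-1 - i)%N.
Proof. lia. Qed.

Let rev_bound i : (i < n)%N -> (n.-1 - i < n)%N.
Proof. lia. Qed.

Let revK i : (i < n)%N -> (n.-1 - (n.-1 - i) = i)%N.
Proof. lia. Qed.

Ltac rc A i j k :=
  let ij := fresh "ij" in let jk := fresh "jk" in let kn := fresh "kn" in
  let jn := fresh "jn" in let lt_in := fresh "lt_in" in
  split=> A i j k ij jk kn; have jn := ltn_trans jk kn;
  have lt_in := ltn_trans ij jn;
    have := A (n.-1 - k)%N (n.-1 - j)%N (n.-1 - i)%N;
  rewrite !rc_lt ?revK ?rev_bound //;
  let B := fresh "B" in move=> B ? ?; apply: B => //;
    by [apply: rev_lt|apply: rev_bound].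

Lemma avoids123_rc : avoids123 n (reverse_complement n f) <-> avoids123 n f.
Proof. rc A i j k. Qed.
Lemma avoids132_rc : avoids132 n (reverse_complement n f) <-> avoids213 n f.
Proof. rc A i j k. Qed.
Lemma avoids231_rc : avoids231 n (reverse_complement n f) <-> avoids312 n f.
Proof. rc A i j k. Qed.
Lemma avoids321_rc : avoids321 n (reverse_complement n f) <-> avoids321 n f.
Proof. rc A i j k. Qed.
End ReverseComplement.

(** * Recurrences *)

Lemma inv_sum_rec1 n (P P0 P1 : (nat -> nat) -> Prop) (j1 :
  (nat -> nat) -> nat) :
  (forall f, involutive_on n.+1 f -> P (dsum1 f) <-> P0 f) ->
  (forall j f, involutive_on n f -> (j <= n)%N ->
     P (add_cycle j f) <-> P1 f /\ j = j1 f) ->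
  (forall f, involutive_on n f -> P1 f -> (j1 f <= n)%N) ->
  inv_sum n.+2 P = 'X * inv_sum n.+1 P0 + inv_sum n P1.
Proof.
move=> PP0 PP1 j1n.
rewrite (@inv_sum_rec n P P0 P1 (fun=> False) j1 (fun=> 0%N)) //.
  by rewrite (@inv_sum0 n (fun=> False)) ?addr0 // => f _.
by move=> j f If jn; rewrite PP1 //; tauto.
Qed.

Definition decreasing_sum n := inv_sum n (avoids12 n).
Definition increasing_sum n := inv_sum n (avoids21 n).
Definition sum123_132 n := inv_sum n (fun f => avoids123 n f /\ avoids132 n f).
Definition sum312_321 n := inv_sum n (fun f => avoids312 n f /\ avoids321 n f).
Definition sum132_213 n := inv_sum n (fun f => avoids132 n f /\ avoids213 n f).
Definition sum312 n := inv_sum n (avoids312 n).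
Definition sum213_312 n := inv_sum n (fun f => avoids213 n f /\ avoids312 n f).
Definition sum213_321 n := inv_sum n (fun f => avoids213 n f /\ avoids321 n f).
Definition sum123_312 n := inv_sum n (fun f => avoids123 n f /\ avoids312 n f).
Definition sum123_321 n := inv_sum n (fun f => avoids123 n f /\ avoids321 n f).

Lemma decreasing_sum_rec n : decreasing_sum n.+2 = decreasing_sum n.
Proof.
rewrite /decreasing_sum (@inv_sum_rec1 n _ (fun=> False) (avoids12 n) (fun=>
  n)) //.
- by rewrite inv_sum0 ?mulr0 ?add0r // => f _.
- by move=> f _; split=> // /avoids12_dsum1.
- by move=> j f If jn; apply: avoids12_add_cycle.
Qed.

Lemma increasing_sum_rec n : increasing_sum n.+2 = 'X * increasing_sum n.+1.
Proof.
rewrite /increasing_sum (@inv_sum_rec1 n _ (avoids21 n.+1) (fun=> False) (fun=>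
  n)) //.
- by rewrite (@inv_sum0 n (fun=> False)) ?addr0 // => f _.
- by move=> f _; apply: avoids21_dsum1.
- by move=> j f If jn; split=> [/avoids21_add_cycle|[]].
Qed.

Lemma sum123_132_2 : sum123_132 2 = 'X ^+ 2 + 1.
Proof.
rewrite /sum123_132 (@inv_sum_rec1 0 _ (fun=> True) (fun=> True) (fun=> 0%N))
  //.
- by rewrite !inv_sum_small // expr1 expr2.
- by move=> f If; rewrite avoids123_132_dsum1.
- move=> j f If jn; split=> _; first by split=> //; lia.
  by split=> p q r; lia.
Qed.

(** The recurrence starts at length 3: for cycles added to the empty involution the positions [n]
    and [n.-1] coincide. *)
Lemma sum123_132_rec n : sum123_132 n.+3 = sum123_132 n.+1 *+ 2.
Proof.
rewrite /sum123_132.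
pose P f := avoids123 n.+1 f /\ avoids132 n.+1 f.
rewrite (@inv_sum_rec n.+1 _ (fun=> False) P P (fun=> n.+1) (fun=> n)) //.
- by rewrite inv_sum0 ?mulr0 ?add0r ?mulr2n // => f _.
- by move=> f If; rewrite avoids123_132_dsum1.
- by move=> j f If jn; rewrite avoids123_132_add_cycle //= /P; tauto.
- by move=> f _ _ _; lia.
Qed.

Lemma sum312_321_rec n : sum312_321 n.+2 = 'X * sum312_321 n.+1 + sum312_321 n.
Proof.
apply: (@inv_sum_rec1 n _ _ _ (fun=> 0%N)) => //.
- by move=> f _; apply: avoids312_321_dsum1.
- by move=> j f If jn; apply: avoids312_321_add_cycle.
Qed.

(* The members of the class that may receive a cycle with [j = f 0 <> 0]. *)
Definition sum132_213_moved n := inv_sum n (fun f =>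
  (0 < n)%N /\ f 0%N <> 0%N /\ avoids132 n f /\ avoids213 n f).

Lemma sum132_213_rec n : sum132_213 n.+2 =
  'X * increasing_sum n.+1 + (sum132_213 n + sum132_213_moved n).
Proof.
apply: (@inv_sum_rec n _ _ _ _ (fun=> n) (fun f => f 0%N)) => //.
- by move=> f _; apply: avoids132_213_dsum1.
- by move=> j f If jn; rewrite avoids132_213_add_cycle //; tauto.
- by move=> f If [n0 _]; move: (If _ n0); lia.
- by move=> f If _ [n0 _]; move: (If _ n0); lia.
Qed.

(** Adding any cycle moves 0, so all the cycle terms of [sum132_213] survive and only the
    fixed-point term disappears. *)
Lemma sum132_213_moved_rec n : sum132_213_moved n.+2 =
  sum132_213 n + sum132_213_moved n.
Proof.
rewrite /sum132_213_moved (@inv_sum_rec n _ (fun=> False)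
  (fun f => avoids132 n f /\ avoids213 n f)
  (fun f => (0 < n)%N /\ f 0%N <> 0%N /\ avoids132 n f /\ avoids213 n f)
  (fun=> n) (fun f => f 0%N)) //.
- by rewrite inv_sum0 ?mulr0 ?add0r // => f _.
- by move=> f _; split=> // -[_ []].
- move=> j f If jn; have cyc := avoids132_213_add_cycle n j f If jn; split.
    by move=> [_ [_ /cyc]]; tauto.
  by move=> /= P12; split=> //; split=> //; apply/cyc; tauto.
- by move=> f If [n0 _]; move: (If _ n0); lia.
- by move=> f If _ [n0 _]; move: (If _ n0); lia.
Qed.

Lemma sum312_rec n :
  sum312 n.+3 = 'X * sum312 n.+2 + (sum312 n.+1 + sum312 n.+1).
Proof.
apply: (@inv_sum_rec n.+1 _ _ _ _ (fun=> 0%N) (fun f => (f 0%N).+1)) => //.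
- by move=> f _; apply: avoids312_dsum1.
- by move=> j f If jn; have lt0n1 : (0 < n.+1)%N by [];
    rewrite avoids312_add_cycle //; tauto.
- by move=> f If _; move: (If 0%N); lia.
Qed.

Lemma sum312_2 : sum312 2 = 'X * sum312 1 + sum312 0.
Proof.
apply: (@inv_sum_rec1 0 _ _ _ (fun=> 0%N)) => //.
- by move=> f _; apply: avoids312_dsum1.
- by move=> j f If jn; rewrite avoids312_add_cycle //=; split;
    [case=> ? [?|[]]|tauto].
Qed.

Lemma sum213_312_rec n :
  sum213_312 n.+2 = 'X * sum213_312 n.+1 + decreasing_sum n.
Proof.
apply: (@inv_sum_rec1 n _ _ _ (fun=> n)) => //.
- by move=> f _; apply: avoids213_312_dsum1.
- by move=> j f If jn; apply: avoids213_312_add_cycle.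
Qed.

(** The members that may receive a cycle. The case [n = 0] admits the empty involution, which
    receives the cycle with [j = 0]. *)
Definition sum213_321_moved n := inv_sum n (fun f =>
  (n = 0 \/ f 0 <> 0)%N /\ avoids213 n f /\ avoids321 n f).

Lemma sum213_321_rec n :
  sum213_321 n.+2 = 'X * sum213_321 n.+1 + sum213_321_moved n.
Proof.
apply: (@inv_sum_rec1 n _ _ _ (fun f => if n == 0 then 0 else f 0)%N) => //.
- by move=> f _; apply: avoids213_321_dsum1.
- move=> j f If jn; rewrite avoids213_321_add_cycle //.
  by case: eqP => n0; [have : j = 0%N by lia|]; tauto.
- by move=> f If _; case: posnP => // n0; move: (If _ n0); lia.
Qed.

Lemma sum213_321_moved_rec n : sum213_321_moved n.+2 = sum213_321_moved n.
Proof.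
rewrite /sum213_321_moved (@inv_sum_rec1 n _ (fun=> False)
  (fun f => (n = 0 \/ f 0 <> 0)%N /\ avoids213 n f /\ avoids321 n f)
  (fun f => if n == 0 then 0 else f 0)%N) //.
- by rewrite inv_sum0 ?mulr0 ?add0r // => f _.
- by move=> f _; split=> // -[[]].
- move=> j f If jn; have cyc := avoids213_321_add_cycle n j f If jn; split.
    move=> [_ /cyc]; case: eqP => n0; [have : j = 0%N by lia|]; tauto.
  move=> /= P12; split; first by right.
  by apply/cyc; move: P12; case: eqP => n0; tauto.
- by move=> f If _; case: posnP => // n0; move: (If _ n0); lia.
Qed.

Lemma sum123_312_2 : sum123_312 2 = 'X * decreasing_sum 1 + decreasing_sum 0.
Proof.
apply: (@inv_sum_rec1 0 _ _ _ (fun=> 0%N)) => //.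
- by move=> f _; apply: avoids123_312_dsum1.
- by move=> j f If jn; rewrite avoids123_312_add_cycle //=; split;
    [case=> [|[_ []]]|tauto].
Qed.

Lemma sum123_312_rec n : sum123_312 n.+3 =
  'X * decreasing_sum n.+2 + (decreasing_sum n.+1 + sum123_312 n.+1).
Proof.
apply: (@inv_sum_rec n.+1 _ _ _ _ (fun=> 0%N) (fun f => (f 0%N).+1)) => //.
- by move=> f _; apply: avoids123_312_dsum1.
- by move=> j f If jn; have lt0n1 : (0 < n.+1)%N by [];
    rewrite avoids123_312_add_cycle //; tauto.
- by move=> f If _; move: (If 0%N); lia.
Qed.

Lemma sum123_321_rec n : sum123_321 n.+2 =
  (if (n <= 1)%N then 'X * decreasing_sum n.+1 else 0) +
  ((if (n <= 2)%N then decreasing_sum n else 0) +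
   (if n == 2%N then decreasing_sum n else 0)).
Proof.
(* The conditions on [n] are moved into the predicates, so that [inv_sum_rec] applies uniformly. *)
have sum_if m (b : bool) : (if b then decreasing_sum m else 0) =
    inv_sum m (fun f => b /\ avoids12 m f).
  case: b; last by rewrite inv_sum0 // => f _ [].
  by apply: eq_inv_sum => f _; split=> [|[]].
have -> : (if (n <= 1)%N then 'X * decreasing_sum n.+1 else 0) =
    'X * (if (n <= 1)%N then decreasing_sum n.+1 else 0).
  by case: ifP; rewrite ?mulr0.
rewrite !sum_if.
apply: (@inv_sum_rec n _ _ _ _ (fun=> 0%N) (fun=> 1%N)) => //.
- by move=> f If; rewrite avoids123_321_dsum1 //; split; lia || tauto.
- move=> j f If jn; rewrite avoids123_321_add_cycle //; split.
    move=> [dec [[n2 ->]|[/eqP n2 ->]]]; first by left; rewrite n2.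
    by right; rewrite n2.
  by move=> [[[n2 dec] ->]|[[/eqP n2 dec] ->]]; split=> //; [left|right].
- by move=> f _ [/eqP-> _].
Qed.

(** * Generating functions *)

Section FpsAlgebra.
Variable R : comUnitRingType.
Implicit Types (a b c : nat -> R) (A B : {fps R}).

Lemma coef_fpsD A B n : fps_coef (A + B) n = fps_coef A n + fps_coef B n.
Proof. by []. Qed.

Lemma coef_fpsXM A n :
  fps_coef (fpsX * A) n = if n is n'.+1 then fps_coef A n' else 0.
Proof.
case: n => [|n] /=; first by rewrite big_ord1 mul0r.
rewrite big_ord_recl mul0r add0r big_ord_recl mul1r subSS subn0 big1 ?addr0 //
  => i _.
by rewrite mul0r.
Qed.

Lemma coef_fpsCM r A n : fps_coef (fpsC r * A) n = r * fps_coef A n.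
Proof.
rewrite /= big_ord_recl /= subn0 big1 ?addr0 // => i _.
by rewrite mul0r.
Qed.

Lemma fps_shift a : Fps a = fpsC (a 0) + fpsX * Fps (fun n => a n.+1).
Proof.
apply/fpsP => n; rewrite coef_fpsD coef_fpsXM;
by case: n => [|n] /=; rewrite ?addr0 ?add0r.
Qed.

(** The recurrence uses [b] only from index 1 on, whence the removal of its constant term. *)
Lemma fps_rec2 (x : R) a b c : (forall n, a n.+2 = x * b n.+1 + c n) ->
  Fps a = fpsC (a 0) + fpsC (a 1) * fpsX +
    fpsC x * fpsX * (Fps b - fpsC (b 0)) + fpsX ^+ 2 * Fps c.
Proof.
move=> a_rec; rewrite fps_shift (fps_shift (fun n => a n.+1)) (fps_shift b).
have -> : Fps (fun n => a n.+2) = fpsC x * Fps (fun n => b n.+1) + Fps c.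
  by apply/fpsP => n; rewrite coef_fpsD coef_fpsCM /= a_rec.
ring.
Qed.

Lemma fps_unit_1DXM A : 1 + fpsX * A \is a GRing.unit.
Proof.
apply: (_ : fps_coef (1 + fpsX * A) 0 \is a GRing.unit).
by rewrite coef_fpsD coef_fpsXM addr0 unitr1.
Qed.

Lemma fps_eq_div A B D : D \is a GRing.unit -> A * D = B -> A = B / D.
Proof. by move=> uD <-; rewrite mulrK. Qed.

Lemma fpsC0 : fpsC 0 = 0 :> {fps R}. Proof. by []. Qed.
Lemma fpsC1 : fpsC 1 = 1 :> {fps R}. Proof. by []. Qed.

Lemma fpsCD r s : fpsC (r + s) = fpsC r + fpsC s :> {fps R}.
Proof. by apply/fpsP => n; rewrite coef_fpsD /=; case: eqP; rewrite ?addr0. Qed.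

Lemma fpsCN r : fpsC (- r) = - fpsC r :> {fps R}.
Proof. by apply/fpsP => n /=; case: eqP; rewrite ?oppr0. Qed.

Lemma fpsCM r s : fpsC (r * s) = fpsC r * fpsC s :> {fps R}.
Proof. by apply/fpsP => n; rewrite coef_fpsCM /=; case: eqP;
  rewrite ?mulr0. Qed.

Lemma Fps0 : Fps (fun=> 0 : R) = 0.
Proof. by apply/fpsP => n /=; rewrite if_same. Qed.

Lemma FpsD a b : Fps (fun n => a n + b n) = Fps a + Fps b.
Proof. by []. Qed.

Lemma fps_rec2_0 a c : (forall n, a n.+2 = c n) ->
  Fps a = fpsC (a 0) + fpsC (a 1) * fpsX + fpsX ^+ 2 * Fps c.
Proof.
move=> a_rec; rewrite (@fps_rec2 0 a (fun=> 0) c) => [|n].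
  by rewrite fpsC0 !mul0r addr0.
by rewrite mul0r add0r.
Qed.

(** * Solving the recurrences for rational series *)

Variable r : R.
Let x := fpsC r.
Let z : {fps R} := fpsX.

Lemma fps_rec2_1 a b c : a 0 = 1 -> a 1 = r -> b 0 = 1 ->
  (forall n, a n.+2 = r * b n.+1 + c n) ->
  Fps a = 1 + x * z * Fps b + z ^+ 2 * Fps c.
Proof. move=> a0 a1 b0 /fps_rec2 ->; rewrite a0 a1 b0 fpsC1 /x /z; ring. Qed.

Lemma gf_even_odd a : a 0 = 1 -> a 1 = r -> (forall n, a n.+2 = a n) ->
  (1 - z ^+ 2) * Fps a = 1 + x * z.
Proof.
move=> a0 a1 /fps_rec2_0 E; rewrite a0 a1 fpsC1 in E.
by rewrite mulrBl mul1r {1}E /x /z; ring.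
Qed.

Lemma gf_power a : a 0 = 1 -> a 1 = r -> (forall n, a n.+2 = r * a n.+1) ->
  (1 - x * z) * Fps a = 1.
Proof.
move=> a0 a1 a_rec; have E : Fps a = 1 + x * z * Fps a + z ^+ 2 * Fps (fun=> 0).
  by apply: fps_rec2_1 => // n; rewrite a_rec addr0.
by rewrite mulrBl mul1r {1}E Fps0; ring.
Qed.

Lemma unit_1B2z2 : 1 - 2 * z ^+ 2 \is a GRing.unit.
Proof. by rewrite (_ : _ - _ = 1 + z * (- 2 * z)) ?fps_unit_1DXM //; ring. Qed.

Lemma unit_1Bxz : 1 - x * z \is a GRing.unit.
Proof. by rewrite (_ : _ - _ = 1 + z * (- x)) ?fps_unit_1DXM //; ring. Qed.

Lemma unit_1Bz2 : 1 - z ^+ 2 \is a GRing.unit.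
Proof. by rewrite (_ : _ - _ = 1 + z * (- z)) ?fps_unit_1DXM //; ring. Qed.

Lemma unit_1BxzBz2 : 1 - x * z - z ^+ 2 \is a GRing.unit.
Proof. by rewrite (_ : _ - _ = 1 + z * (- x - z)) ?fps_unit_1DXM //; ring. Qed.

Lemma unit_1BxzB2z2 : 1 - x * z - 2 * z ^+ 2 \is a GRing.unit.
Proof. by rewrite (_ : _ - _ = 1 + z * (- x - 2 * z)) ?fps_unit_1DXM //;
  ring. Qed.

Lemma gf_doubling a : a 0 = 1 -> a 1 = r -> a 2 = r ^+ 2 + 1 ->
  (forall n, a n.+3 = a n.+1 *+ 2) ->
  Fps a = (1 + x * z + (x ^+ 2 - 1) * z ^+ 2) / (1 - 2 * z ^+ 2).
Proof.
move=> a0 a1 a2 a_rec; apply: fps_eq_div unit_1B2z2 _.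
(* The correction [r * r - 1] extends the doubling rule to index 2, where the value is [r ^+ 2 + 1]
   instead of 2. *)
have /fps_rec2_0 E n : a n.+2 = a n + a n + (if n == 0%N then r * r - 1 else 0).
  case: n => [|n]; last by rewrite a_rec addr0 mulr2n.
  by rewrite a2 a0 /=; ring.
rewrite a0 a1 fpsC1 !FpsD -[Fps (fun n => if _ then _ else _)]/(fpsC _) in E.
rewrite fpsCD fpsCN fpsCM fpsC1 in E.
by rewrite mulrBr mulr1 {1}E /x /z; ring.
Qed.

Lemma gf_fibonacci a : a 0 = 1 -> a 1 = r ->
  (forall n, a n.+2 = r * a n.+1 + a n) -> Fps a = 1 / (1 - x * z - z ^+ 2).
Proof.
move=> a0 a1 a_rec; apply: fps_eq_div unit_1BxzBz2 _.
have E := fps_rec2_1 a0 a1 a0 a_rec.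
by rewrite !mulrBr mulr1 {1}E; ring.
Qed.

Lemma gf_palindromic a b c : a 0 = 1 -> a 1 = r -> b 0 = 1 -> b 1 = r ->
  c 0 = 0 -> c 1 = 0 -> (forall n, b n.+2 = r * b n.+1) ->
  (forall n, a n.+2 = r * b n.+1 + (a n + c n)) ->
  (forall n, c n.+2 = a n + c n) ->
  Fps a = (1 - z ^+ 2) / ((1 - x * z) * (1 - 2 * z ^+ 2)).
Proof.
move=> a0 a1 b0 b1 c0 c1 b_rec a_rec c_rec.
apply: fps_eq_div; first by rewrite unitrM unit_1Bxz unit_1B2z2.
have B := gf_power b0 b1 b_rec; have A := fps_rec2_1 a0 a1 b0 a_rec.
have C := fps_rec2_0 c_rec.
rewrite c0 c1 fpsC0 FpsD mul0r !add0r -/z in C; rewrite FpsD -C in A.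
(* Here [b] counts the increasing members and [c] those moving 0. Eliminating [c] leaves a linear
   equation between the series of [a] and [b]. *)
have AB : Fps a = Fps b + Fps c.
  by rewrite A; congr (_ + _); rewrite -B mulrBl mul1r subrK.
have C' : Fps c = Fps a - Fps b by rewrite AB addrAC subrr add0r.
have A2 : Fps a - Fps b - z ^+ 2 * (Fps a + (Fps a - Fps b)) = 0.
  by rewrite -C' -C subrr.
apply/eqP; rewrite -subr_eq0; apply/eqP.
transitivity ((1 - x * z) * (Fps a - Fps b - z ^+ 2 * (Fps a + (Fps a - Fps
  b))) +
  (1 - z ^+ 2) * ((1 - x * z) * Fps b - 1)); first by ring.
by rewrite A2 B subrr !mulr0 addr0.
Qed.

Lemma gf_layered a : a 0 = 1 -> a 1 = r -> a 2 = r * a 1 + a 0 ->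
  (forall n, a n.+3 = r * a n.+2 + (a n.+1 + a n.+1)) ->
  Fps a = (1 - z ^+ 2) / (1 - x * z - 2 * z ^+ 2).
Proof.
move=> a0 a1 a2 a_rec; apply: fps_eq_div unit_1BxzB2z2 _.
(* The correction at [n = 0] is -1 because [a 2] contains [a 0 = 1] only once. *)
have rec n : a n.+2 = r * a n.+1 + (a n + a n + (if n == 0%N then - 1 else 0)).
  by case: n => [|n]; rewrite ?a_rec ?a2 ?a0 /= ?addr0 ?addrK.
have E := fps_rec2_1 a0 a1 a0 rec.
rewrite !FpsD -[Fps (fun n => if _ then _ else _)]/(fpsC _) fpsCN fpsC1 in E.
by rewrite !mulrBr mulr1 {1}E; ring.
Qed.

Lemma gf_unimodal a w : a 0 = 1 -> a 1 = r -> w 0 = 1 -> w 1 = r ->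
  (forall n, w n.+2 = w n) -> (forall n, a n.+2 = r * a n.+1 + w n) ->
  Fps a = (1 + x * z ^+ 3) / ((1 - x * z) * (1 - z ^+ 2)).
Proof.
move=> a0 a1 w0 w1 w_rec a_rec.
apply: fps_eq_div; first by rewrite unitrM unit_1Bxz unit_1Bz2.
have W := gf_even_odd w0 w1 w_rec; have E := fps_rec2_1 a0 a1 a0 a_rec.
have A : (1 - x * z) * Fps a = 1 + z ^+ 2 * Fps w.
  by rewrite mulrBl mul1r {1}E; ring.
transitivity ((1 - z ^+ 2) * ((1 - x * z) * Fps a)); first by ring.
transitivity (1 - z ^+ 2 + z ^+ 2 * ((1 - z ^+ 2) * Fps w));
  first by rewrite A; ring.
by rewrite W; ring.
Qed.

Lemma gf_block_swap a c : a 0 = 1 -> a 1 = r -> c 0 = 1 -> c 1 = 0 ->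
  (forall n, c n.+2 = c n) -> (forall n, a n.+2 = r * a n.+1 + c n) ->
  Fps a = 1 / ((1 - x * z) * (1 - z ^+ 2)).
Proof.
move=> a0 a1 c0 c1 /fps_rec2_0 C a_rec.
apply: fps_eq_div; first by rewrite unitrM unit_1Bxz unit_1Bz2.
rewrite c0 c1 fpsC0 fpsC1 mul0r addr0 -/z in C.
have E := fps_rec2_1 a0 a1 a0 a_rec.
(* The series of [c] absorbs the constant term, since it satisfies [Fps c = 1 + z ^+ 2 * Fps c]. *)
have A : (1 - x * z) * Fps a = Fps c.
  by rewrite mulrBl mul1r {1}E [RHS]C; ring.
transitivity ((1 - z ^+ 2) * ((1 - x * z) * Fps a)); first by ring.
by rewrite A mulrBl mul1r {1}C addrK.
Qed.

Lemma gf_two_layers a w : a 0 = 1 -> a 1 = r -> w 0 = 1 -> w 1 = r ->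
  (forall n, w n.+2 = w n) -> a 2 = r * w 1 + w 0 ->
  (forall n, a n.+3 = r * w n.+2 + (w n.+1 + a n.+1)) ->
  Fps a = (1 + x * z + (x ^+ 2 - 1) * z ^+ 2 + x * z ^+ 3 + z ^+ 4)
    / (1 - z ^+ 2) ^+ 2.
Proof.
move=> a0 a1 w0 w1 w_rec a2 a_rec.
apply: fps_eq_div; first by rewrite unitrX ?unit_1Bz2.
have rec n : a n.+2 = r * w n.+1 + (w n + a n + (if n == 0%N then - 1 else 0)).
  by case: n => [|n]; rewrite ?a_rec ?a2 ?a0 /= ?addr0 ?addrK.
have W := gf_even_odd w0 w1 w_rec; have E := fps_rec2_1 a0 a1 w0 rec.
rewrite !FpsD -[Fps (fun n => if _ then _ else _)]/(fpsC _) fpsCN fpsC1 in E.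
have A : (1 - z ^+ 2) * Fps a = 1 - z ^+ 2 + (x * z + z ^+ 2) * Fps w.
  by rewrite mulrBl mul1r {1}E; ring.
transitivity ((1 - z ^+ 2) * ((1 - z ^+ 2) * Fps a)); first by ring.
transitivity ((1 - z ^+ 2) ^+ 2 + (x * z + z ^+ 2) * ((1 - z ^+ 2) * Fps w)).
  by rewrite A; ring.
by rewrite W; ring.
Qed.

Lemma gf_degree4 a : a 0 = 1 -> a 1 = r -> a 2 = r ^+ 2 + 1 -> a 3 = 2 * r ->
  a 4 = 2 -> (forall n, a n.+4.+1 = 0) ->
  Fps a = 1 + x * z + (x ^+ 2 + 1) * z ^+ 2 + 2 * x * z ^+ 3 + 2 * z ^+ 4.
Proof.
move=> a0 a1 a2 a3 a4 a5.
rewrite fps_shift (fps_shift (fun n => a n.+1)) (fps_shift (fun n => a n.+2)).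
rewrite (fps_shift (fun n => a n.+3)) (fps_shift (fun n => a n.+4)).
have -> : (fun n => a n.+4.+1) = fun=> 0 by apply/funext.
have fpsC2 : fpsC 2 = 2 :> {fps R} by rewrite !mulr2n fpsCD.
rewrite Fps0 a0 a1 a2 a3 a4 !expr2 fpsCD !fpsCM fpsC2 fpsC1 /x /z.
ring.
Qed.
End FpsAlgebra.

(** * Generating functions of the classes *)

Lemma eq_Fps_inv_sum (P Q : nat -> (nat -> nat) -> Prop) :
  (forall n f, involutive_on n f -> P n f <-> Q n f) ->
  Fps (fun n => inv_sum n (P n)) = Fps (fun n => inv_sum n (Q n)).
Proof. by move=> PQ; apply/fpsP => n; apply: eq_inv_sum => f; apply: PQ. Qed.

Lemma eq_Fps_inv_sum_rc (P Q : nat -> (nat -> nat) -> Prop) :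
  (forall n f, involutive_on n f -> P n (reverse_complement n f) <-> Q n f) ->
  Fps (fun n => inv_sum n (P n)) = Fps (fun n => inv_sum n (Q n)).
Proof.
move=> PQ; apply/fpsP => n /=; rewrite inv_sum_reverse_complement.
by apply: eq_inv_sum => f; apply: PQ.
Qed.

(** On at most one point avoidance is vacuous, which yields the initial values 1 and ['X]. *)
Ltac small := apply: inv_sum_small => // f _; do ?split; move=> ? ? *; lia.

Lemma fps_sum123_132 : Fps sum123_132 =
  (1 + fpsC 'X * fpsX + (fpsC 'X ^+ 2 - 1) * fpsX ^+ 2) / (1 - 2 * fpsX ^+ 2).
Proof. by apply: gf_doubling sum123_132_2 sum123_132_rec; small. Qed.

Lemma fps_sum312_321 : Fps sum312_321 = 1 / (1 - fpsC 'X * fpsX - fpsX ^+ 2).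
Proof. by apply: gf_fibonacci sum312_321_rec; small. Qed.

Lemma fps_sum132_213 : Fps sum132_213 =
  (1 - fpsX ^+ 2) / ((1 - fpsC 'X * fpsX) * (1 - 2 * fpsX ^+ 2)).
Proof.
apply: gf_palindromic increasing_sum_rec sum132_213_rec sum132_213_moved_rec;
  try small.
  by apply: inv_sum0 => f _ [].
by apply: inv_sum0 => f If [_ []]; case: (If 0%N) => //; lia.
Qed.

Lemma fps_sum312 : Fps sum312 =
  (1 - fpsX ^+ 2) / (1 - fpsC 'X * fpsX - 2 * fpsX ^+ 2).
Proof. by apply: gf_layered sum312_2 sum312_rec; small. Qed.

Lemma fps_sum213_312 : Fps sum213_312 =
  (1 + fpsC 'X * fpsX ^+ 3) / ((1 - fpsC 'X * fpsX) * (1 - fpsX ^+ 2)).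
Proof. by apply: gf_unimodal decreasing_sum_rec sum213_312_rec; small. Qed.

Lemma fps_sum213_321 : Fps sum213_321 =
  1 / ((1 - fpsC 'X * fpsX) * (1 - fpsX ^+ 2)).
Proof.
apply: gf_block_swap sum213_321_moved_rec sum213_321_rec; try small.
  (* The initial values are 1 and 0: the empty involution counts, while a single point is fixed. *)
  by apply: inv_sum_small => // f _; split; [left|split=> p q r; lia].
by apply: inv_sum0 => f If [[]] //; case: (If 0%N) => //; lia.
Qed.

Lemma fps_sum123_312 : Fps sum123_312 =
  (1 + fpsC 'X * fpsX + (fpsC 'X ^+ 2 - 1) * fpsX ^+ 2
     + fpsC 'X * fpsX ^+ 3 + fpsX ^+ 4) / (1 - fpsX ^+ 2) ^+ 2.
Proof.
by apply: gf_two_layers decreasing_sum_rec sum123_312_2 sum123_312_rec; small.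
Qed.

Lemma fps_sum123_321 : Fps sum123_321 =
  1 + fpsC 'X * fpsX + (fpsC 'X ^+ 2 + 1) * fpsX ^+ 2
    + 2 * fpsC 'X * fpsX ^+ 3 + 2 * fpsX ^+ 4.
Proof.
have dec0 : decreasing_sum 0 = 1 by small.
have dec1 : decreasing_sum 1 = 'X by small.
apply: gf_degree4; try small.
- by rewrite sum123_321_rec /= dec0 dec1 addr0 expr2.
- by rewrite sum123_321_rec /= decreasing_sum_rec dec0 dec1 mulr1 addr0 mulr2n
    mulrDl mul1r.
- by rewrite sum123_321_rec /= decreasing_sum_rec dec0 add0r.
by move=> n; rewrite sum123_321_rec /= !addr0.
Qed.

Theorem theorem6p4 :
  let x : {fps {poly int}} := fpsC 'X in
  let z : {fps {poly int}} := fpsX in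
  (* (a) *)
  (fp_gf [set p123; p132] = fp_gf [set p123; p213] /\
   fp_gf [set p123; p213] =
     (1 + x * z + (x ^+ 2 - 1) * z ^+ 2) / (1 - 2 * z ^+ 2)) /\
  (* (b) *)
  (fp_gf [set p231; p321] = fp_gf [set p312; p321] /\
   fp_gf [set p312; p321] = 1 / (1 - x * z - z ^+ 2)) /\
  (* (c) *)
  fp_gf [set p132; p213] =
    (1 - z ^+ 2) / ((1 - x * z) * (1 - 2 * z ^+ 2)) /\
  (* (d) *)
  fp_gf [set p231; p312] =
    (1 - z ^+ 2) / (1 - x * z - 2 * z ^+ 2) /\
  (* (e) *)
  (fp_gf [set p132; p231] = fp_gf [set p213; p231] /\
   fp_gf [set p213; p231] = fp_gf [set p132; p312] /\
   fp_gf [set p132; p312] = fp_gf [set p213; p312] /\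
   fp_gf [set p213; p312] =
     (1 + x * z ^+ 3) / ((1 - x * z) * (1 - z ^+ 2))) /\
  (* (f) *)
  (fp_gf [set p132; p321] = fp_gf [set p213; p321] /\
   fp_gf [set p213; p321] = 1 / ((1 - x * z) * (1 - z ^+ 2))) /\
  (* (g) *)
  (fp_gf [set p123; p231] = fp_gf [set p123; p312] /\
   fp_gf [set p123; p312] =
     (1 + x * z + (x ^+ 2 - 1) * z ^+ 2 + x * z ^+ 3 + z ^+ 4)
       / (1 - z ^+ 2) ^+ 2) /\
  (* (h) *)
  fp_gf [set p123; p321] =
    1 + x * z + (x ^+ 2 + 1) * z ^+ 2 + 2 * x * z ^+ 3 + 2 * z ^+ 4.
Proof.
move=> x z.
have a123 := @avoids_p123; have a132 := @avoids_p132; have a213 := @avoids_p213.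
have a231 := @avoids_p231; have a312 := @avoids_p312; have a321 := @avoids_p321.
have inv := avoids231_312.
have rc123 := avoids123_rc; have rc132 := avoids132_rc.
have rc231 := avoids231_rc; have rc321 := avoids321_rc.
split.
  split; last first.
    rewrite -fps_sum123_132 (fp_gf_pair a123 a213).
    (* Reverse-complement fixes 123 and exchanges 132 with 213. *)
    by symmetry; apply: eq_Fps_inv_sum_rc => n f If; rewrite rc123 ?rc132.
  rewrite (fp_gf_pair a123 a132) (fp_gf_pair a123 a213).
  by apply: eq_Fps_inv_sum_rc => n f If; rewrite rc123 ?rc132.
split.
  split; last by rewrite -fps_sum312_321 (fp_gf_pair a312 a321).
  rewrite (fp_gf_pair a231 a321) (fp_gf_pair a312 a321).
  by apply: eq_Fps_inv_sum => n f If; rewrite inv.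
split; first by rewrite -fps_sum132_213 (fp_gf_pair a132 a213).
split.
  rewrite -fps_sum312 (fp_gf_pair a231 a312).
  by apply: eq_Fps_inv_sum => n f If; rewrite inv //; tauto.
split.
  (* All four pairs reduce to 213 and 312: reverse-complement handles [E1], and the equivalence of
     231 and 312 on involutions handles [E2] and [E3]. *)
  have E1 : fp_gf [set p132; p231] = Fps sum213_312.
    rewrite (fp_gf_pair a132 a231).
    by apply: eq_Fps_inv_sum_rc => n f If; rewrite rc132 ?rc231.
  have E2 : fp_gf [set p213; p231] = Fps sum213_312.
    rewrite (fp_gf_pair a213 a231).
    by apply: eq_Fps_inv_sum => n f If; rewrite inv.
  have E3 : fp_gf [set p132; p312] = fp_gf [set p132; p231].
    rewrite (fp_gf_pair a132 a312) (fp_gf_pair a132 a231).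
    by apply: eq_Fps_inv_sum => n f If; rewrite inv.
  have E4 : fp_gf [set p213;
    p312] = Fps sum213_312 by rewrite (fp_gf_pair a213 a312).
  by rewrite E3 E1 E2 E4 fps_sum213_312.
split.
  split; last by rewrite -fps_sum213_321 (fp_gf_pair a213 a321).
  rewrite (fp_gf_pair a132 a321) (fp_gf_pair a213 a321).
  by apply: eq_Fps_inv_sum_rc => n f If; rewrite rc132 ?rc321.
split.
  split; last by rewrite -fps_sum123_312 (fp_gf_pair a123 a312).
  rewrite (fp_gf_pair a123 a231) (fp_gf_pair a123 a312).
  by apply: eq_Fps_inv_sum => n f If; rewrite inv.
by rewrite -fps_sum123_321 (fp_gf_pair a123 a321).
Qed.
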